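(* \textsc{Ext EM}, parameterized by the dual parameter, is in $\mathsf{FPT}$.
   Context: \textsc{Ext EM}: the input is a finite simple undirected graph $G=(V,E)$ and $U\subseteq E$; the question is whether there exists an inclusion-wise maximal matching $M$ of $G$ with $M\subseteq U$. The dual parameter is $|E|-|U|$ (the number of forbidden edges $E\setminus U$). *)

(* Defs.v *)
From mathcomp Require Import all_boot.

Set Implicit Arguments.
Unset Strict Implicit.
Unset Printing Implicit Defensive.

(* The random access machine of Cook and Reckhow, with natural numbers in its registers, cut-off
subtraction and uniform cost.  Addition and subtraction are the only arithmetic
operations, so the registers hold numbers of polynomially many bits after
polynomially many steps, and the model is polynomially equivalent to Turing
machines. *)

Inductive instr : Type :=
| Const of nat & nat
| Add of nat & nat & nat
| Sub of nat & nat & nat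
| Fetch of nat & nat   (* indirect read *)
| Store of nat & nat   (* indirect write *)
| Read of nat
| Jump of nat & nat.

Definition program := seq instr.

Record state := State {
  pc : nat;
  regs : nat -> nat;
  input : seq nat
}.

Definition upd (r : nat -> nat) (i v : nat) : nat -> nat :=
  fun j => if j == i then v else r j.

(* Reading past the end of the input yields 0. *)
Definition exec (a : instr) (s : state) : state :=
  let: State p r w := s in
  match a with
  | Const i c => State p.+1 (upd r i c) w
  | Add i j k => State p.+1 (upd r i (r j + r k)) w
  | Sub i j k => State p.+1 (upd r i (r j - r k)) w
  | Fetch i j => State p.+1 (upd r i (r (r j))) w
  | Store i j => State p.+1 (upd r (r i) (r j)) w
  | Read i => State p.+1 (upd r i (head 0 w)) (behead w)
  | Jump i l => State (if 0 < r i then l else p.+1) r w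
  end.

(* The machine has halted when the program counter is outside the program; a
   halted machine stays in its state. *)
Definition step (P : program) (s : state) : state :=
  if onth P (pc s) is Some a then exec a s else s.

Definition halted (P : program) (s : state) : bool := size P <= pc s.

Definition init (w : seq nat) : state := State 0 (fun=> 0) w.

Definition run (P : program) (w : seq nat) (t : nat) : state :=
  iter t (step P) (init w).

(* On input w, P halts after at most t steps with output v, found in R_0. *)
Definition outputs_within (P : program) (w : seq nat) (t v : nat) : Prop :=
  halted P (run P w t) /\ regs (run P w t) 0 = v.

Definition computable (f : nat -> nat) : Prop :=
  exists P : program, forall k, exists t, outputs_within P [:: k] t (f k).

Definition parameterized_problem := seq bool -> nat -> Prop.

(* The machine is given the parameter, the length of the word, and its bits. *)
Definition encode_input (x : seq bool) (k : nat) : seq nat :=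
  [:: k, size x & map nat_of_bool x].

(* The summand 1 only matters for the empty word. *)
Definition FPT (L : parameterized_problem) : Prop :=
  exists (P : program) (f : nat -> nat) (c : nat),
    computable f /\
    forall (x : seq bool) (k : nat), exists b : bool,
      outputs_within P (encode_input x k) (f k * (size x + 1) ^ c) b
      /\ (b <-> L x k).

Record sgraph (V : finType) := SGraph {
  edges : {set {set V}};
  edgesP : {in edges, forall e : {set V}, #|e| = 2}
}.

Definition matching (V : finType) (G : sgraph V) : pred {set {set V}} :=
  fun M => (M \subset edges G) && trivIset M.

Definition maximal_matching (V : finType) (G : sgraph V) (M : {set {set V}}) :
  bool := maxset (matching G) M.

Definition ext_em (V : finType) (G : sgraph V) (U : {set {set V}}) : Prop :=
  exists2 M : {set {set V}}, maximal_matching G M & M \subset U.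

(* The adjacency matrix of ('I_n, F), row by row. *)
Definition adjacency_bits (n : nat) (F : {set {set 'I_n}}) : seq bool :=
  [seq [set i; j] \in F | i <- enum 'I_n, j <- enum 'I_n].

(* The length 2 * n ^ 2 of the word determines n. *)
Definition encode_instance (n : nat) (G : sgraph 'I_n) (U : {set {set 'I_n}}) :
  seq bool := adjacency_bits (edges G) ++ adjacency_bits U.

(* Words that do not encode an instance, and pairs whose second component is not
   the dual parameter of the encoded instance, are not in the language. *)
Definition ext_em_dual : parameterized_problem := fun x k =>
  exists (n : nat) (G : sgraph 'I_n) (U : {set {set 'I_n}}),
    [/\ U \subset edges G, x = encode_instance G U,
        k = #|edges G| - #|U| & ext_em G U].

(* Main.v *)
(* Only the at most 2k ends of the k forbidden edges (the terminals) matter: a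
   matching inside U that touches every forbidden edge extends greedily inside
   U to a maximal matching of G, and conversely.  Keep only the edges of such a
   matching that meet a terminal.  If an edge of it leads from a terminal i to a
   non-terminal that is preceded by at least 2k non-terminal neighbours of i,
   then one of these is unmatched and can replace it.  So it suffices to search
   among the at most 8k^2 pairs (i, j) in which j is a terminal or one of the
   first 2k non-terminal neighbours of i, that is, to try 2^O(k^2) subsets.
   Bounded for-loops suffice for this search, so that its running time can be
   read off from the loop bounds. *)
Require Import Defs.
From mathcomp Require Import all_boot.
From mathcomp Require Import zify.

Set Implicit Arguments.
Unset Strict Implicit.
Unset Printing Implicit Defensive.

(** * A loop language and its compilation *)

(** The exchange is harmless because both ends of a forbidden edge are terminals: giving up a
    non-terminal partner uncovers no forbidden edge. Orienting each relevant matching edge away from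
    a terminal turns the matching into a map, in which an exchange changes a single value. On the
    machine, the time bound must hold for every word, malformed ones included, and its factor [f]
    must itself be computable. So every loop bound is known when its loop starts: it is the length
    of the word, or [n], which is computed from that length alone and never exceeds it, or a number
    that depends only on [k]. The exponent [width k] is (4k)^2 instead of the 8k^2 that would
    suffice, because [2 ^ width k] is then produced by doubling in two nested loops of 4k rounds
    each. The same loops, started from another constant than 1, compute [f]. Edges are always
    handled as ordered pairs of vertices, so that k forbidden edges are counted as 2k. *)

Inductive expr : Type :=
| Lit of nat
| Var of nat
| Bin of bool & expr & expr   (* sum or cut-off difference *)
| Get of nat & expr.

Inductive cmd : Type :=
| Assign of nat & expr
| Put of nat & expr & expr
| Input of nat
| Seq of cmd & cmd
| If of expr & cmd
| For of nat & nat & cmd.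

(* [cell m 0] holds the scalar variables, and [cell m a] with [0 < a] an array. *)
Record memory := Memory { cell : nat -> nat -> nat; tape : seq nat }.

Definition write (m : memory) (a i v : nat) : memory :=
  Memory (fun b j => if (b == a) && (j == i) then v else cell m b j) (tape m).

Fixpoint eval (m : memory) (e : expr) : nat :=
  match e with
  | Lit c => c
  | Var v => cell m 0 v
  | Bin b e1 e2 => (if b then addn else subn) (eval m e1) (eval m e2)
  | Get a e => cell m a (eval m e)
  end.

Fixpoint sem (c : cmd) : memory -> memory :=
  match c with
  | Assign v e => fun m => write m 0 v (eval m e)
  | Put a e1 e2 => fun m => write m a (eval m e1) (eval m e2)
  | Input v => fun m =>
      write (Memory (cell m) (behead (tape m))) 0 v (head 0 (tape m))
  | Seq c1 c2 => fun m => sem c2 (sem c1 m)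
  | If e c => fun m => if 0 < eval m e then sem c m else m
  | For i v c => fun m =>
      foldl (fun m j => sem c (write m 0 i j)) m (iota 0 (cell m 0 v))
  end.

Fixpoint touches (c : cmd) (a i : nat) : bool :=
  match c with
  | Assign v _ | Input v => (a == 0) && (i == v)
  | Put b _ _ => a == b
  | Seq c1 c2 => touches c1 a i || touches c2 a i
  | If _ c => touches c a i
  | For v _ c => (a == 0) && (i == v) || touches c a i
  end.

Lemma sem_frame c m a i : ~~ touches c a i -> cell (sem c m) a i = cell m a i.
Proof.
elim: c m => [v e|b e1 e2|v|c1 IH1 c2 IH2|e c IH|v w c IH] m /=.
- by move/negbTE => ->.
- by move/negbTE => ->.
- by move/negbTE => ->.
- by rewrite negb_or => /andP[h1 h2]; rewrite IH2 // IH1.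
- by move=> h; case: ifP => // _; exact: IH.
- rewrite negb_or => /andP[/negbTE h1 h2].
  move: (iota 0 _) => s; elim: s m => //= j s IHs m.
  by rewrite IHs IH //= h1.
Qed.

(* The cell [i] of the array [a] is the register [8 * i + a].  The expressions
   are evaluated in the registers of class 1, and the loops count in those of
   class 2. *)
Definition reg (a i : nat) : nat := 8 * i + a.

Definition legal (a : nat) : bool := (a < 8) && (a != 1) && (a != 2).

Lemma reg_eq a b i j :
  a < 8 -> b < 8 -> (reg a i == reg b j) = (a == b) && (i == j).
Proof. by rewrite /reg => ha hb; apply/eqP/andP => [|[/eqP -> /eqP ->]]; lia. Qed.

Lemma legal_lt8 a : legal a -> a < 8.
Proof. by case/andP => /andP[]. Qed.

(** The three doublings supply the factor 8 of [reg], as the machine cannot multiply. *)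
Definition locate (a d : nat) : seq instr :=
  let t := reg 1 d in let u := reg 1 d.+1 in
  [:: Add t t t; Add t t t; Add t t t; Const u a; Add t t u].

Fixpoint compile_expr (e : expr) (d : nat) : seq instr :=
  let t := reg 1 d in let u := reg 1 d.+1 in
  match e with
  | Lit c => [:: Const t c]
  | Var v => [:: Const t 0; Add t t (reg 0 v)]
  | Bin b e1 e2 =>
      compile_expr e1 d ++ compile_expr e2 d.+1
        ++ [:: (if b then Add else Defs.Sub) t t u]
  | Get a e => compile_expr e d ++ locate a d ++ [:: Fetch t t]
  end.

(** In [sem], the bound of a loop is read once, on entry, and the body may overwrite the bound and
    the counter. The machine therefore keeps the number [h] of remaining rounds and the bound [g] in
    two hidden registers per nesting depth [d], and recomputes the counter as [g - h] in each round.
    Jumps are absolute, whence the address [off]; a preceding [Const t 1] makes a jump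
    unconditional. *)
Fixpoint compile (c : cmd) (d off : nat) : seq instr :=
  let t := reg 1 0 in
  match c with
  | Assign v e =>
      compile_expr e 0 ++ [:: Const (reg 0 v) 0; Add (reg 0 v) (reg 0 v) t]
  | Put a e1 e2 =>
      compile_expr e1 0 ++ locate a 0 ++ compile_expr e2 1
        ++ [:: Store t (reg 1 1)]
  | Input v => [:: Read (reg 0 v)]
  | Seq c1 c2 =>
      let p := compile c1 d off in p ++ compile c2 d (off + size p)
  | If e c =>
      let p := compile_expr e 0 in
      let q := compile c d (off + size p + 3) in
      p ++ [:: Jump t (off + size p + 3); Const t 1;
               Jump t (off + size p + 3 + size q)] ++ q
  | For i v c =>
      let h := reg 2 d.*2 in let g := reg 2 d.*2.+1 in
      let q := compile c d.+1 (off + 10) in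
      [:: Const h 0; Add h h (reg 0 v); Const g 0; Add g g (reg 0 v)]
        ++ [:: Jump h (off + 7); Const t 1; Jump t (off + 10 + size q + 2)]
        ++ [:: Defs.Sub (reg 0 i) g h; Const t 1; Defs.Sub h h t]
        ++ q ++ [:: Const t 1; Jump t (off + 4)]
  end.

Fixpoint wf_expr (e : expr) : bool :=
  match e with
  | Lit _ | Var _ => true
  | Bin _ e1 e2 => wf_expr e1 && wf_expr e2
  | Get a e => legal a && wf_expr e
  end.

Fixpoint wf (c : cmd) : bool :=
  match c with
  | Assign _ e => wf_expr e
  | Put a e1 e2 => [&& legal a, wf_expr e1 & wf_expr e2]
  | Input _ => true
  | Seq c1 c2 => wf c1 && wf c2
  | If e c => wf_expr e && wf c
  | For _ _ c => wf c
  end.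

(** * Simulation of the loop language on the machine *)

Definition agrees (m : memory) (r : nat -> nat) : Prop :=
  forall a i, legal a -> r (reg a i) = cell m a i.

Definition straight (a : instr) : bool := if a is Jump _ _ then false else true.

Definition execs (p : seq instr) (s : state) : state :=
  foldl (fun s a => exec a s) s p.

#[local] Arguments upd : simpl never.

Lemma execs_cat p q s : execs (p ++ q) s = execs q (execs p s).
Proof. exact: foldl_cat. Qed.

Definition code_at (P : program) (off : nat) (p : seq instr) : Prop :=
  exists l r, P = l ++ p ++ r /\ size l = off.

Lemma code_at_cat P off p q :
  code_at P off (p ++ q) -> code_at P off p /\ code_at P (off + size p) q.
Proof.
case=> l [r [-> <-]]; split; first by exists l, (q ++ r); rewrite -!catA.
by exists (l ++ p), r; rewrite -!catA size_cat.
Qed.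

Lemma code_at_step P off a p s :
  code_at P off (a :: p) -> pc s = off -> step P s = exec a s.
Proof.
case=> l [r [-> <-]] hs; rewrite /step hs.
by rewrite onth_cat ltnn subnn.
Qed.

Lemma run_straight P off p s :
  code_at P off p -> pc s = off -> all straight p ->
  iter (size p) (step P) s = execs p s /\ pc (execs p s) = off + size p.
Proof.
elim: p off s => [|a p IH] off s; first by rewrite addn0.
move=> hP hs /= /andP[ha hp].
have [] := IH off.+1 (exec a s) _ _ hp.
- by rewrite -addn1; case: (@code_at_cat P off [:: a] p hP).
- by case: s hs a ha {hP} => ? ? ? /= -> [].
by rewrite -iterS iterSr (code_at_step hP hs) addSnnS => -> ->.
Qed.

Lemma straight_expr e d : all straight (compile_expr e d).
Proof.
by elim: e d => [||[] e1 h1 e2 h2|a e h] d //=; rewrite !all_cat ?h1 ?h2 ?h.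
Qed.

(** The temporaries form a stack: an expression evaluated at level [d] may overwrite only these
    registers, so that the operands waiting below survive. *)
Definition temp_above (d y : nat) : Prop := exists2 j, d <= j & y = reg 1 j.

Lemma legal_not_temp d a i : legal a -> ~ temp_above d (reg a i).
Proof.
move=> /andP[/andP[ha h1] _] [j _ /eqP]; rewrite reg_eq // => /andP[/eqP e _].
by rewrite e in h1.
Qed.

Lemma loop_not_temp d i : ~ temp_above d (reg 2 i).
Proof. by case=> j _ /eqP; rewrite reg_eq. Qed.

Lemma temp_not_above d : ~ temp_above d.+1 (reg 1 d).
Proof. by case=> j hj /eqP; rewrite reg_eq //= => /eqP; lia. Qed.

Lemma temp_aboveW d y : temp_above d.+1 y -> temp_above d y.
Proof. by case=> j /ltnW hj ->; exists j. Qed.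

Lemma upd_neq r x v y : y <> x -> upd r x v y = r y.
Proof. by rewrite /upd => /eqP/negbTE ->. Qed.

Lemma upd_eq r x v : upd r x v x = v.
Proof. by rewrite /upd eqxx. Qed.

Lemma execs_locate a d s :
  let s' := execs (locate a d) s in
  [/\ regs s' (reg 1 d) = reg a (regs s (reg 1 d)), input s' = input s
    & forall y, ~ temp_above d y -> regs s' y = regs s y].
Proof.
case: s => p r w /=; rewrite /upd.
split=> // [|y hy]; first by rewrite !reg_eq //= !eqxx /= (ltn_eqF (ltnSn d)) /reg; lia.
have hy1 : (y == reg 1 d) = false by apply/eqP => e; apply: hy; exists d.
have hy2 : (y == reg 1 d.+1) = false by apply/eqP => e; apply: hy; exists d.+1.
by rewrite hy1 hy2.
Qed.

Lemma agrees_above m d r r' :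
  agrees m r -> (forall y, ~ temp_above d y -> r' y = r y) -> agrees m r'.
Proof. by move=> h e a i ha; rewrite e ?h //; apply: legal_not_temp. Qed.

Lemma execs_expr e d m s :
  wf_expr e -> agrees m (regs s) ->
  let s' := execs (compile_expr e d) s in
  [/\ regs s' (reg 1 d) = eval m e, input s' = input s
    & forall y, ~ temp_above d y -> regs s' y = regs s y].
Proof.
elim: e d s => [c|v|b e1 IH1 e2 IH2|a e IH] d s.
- case: s => p r w _ _ /=; split; rewrite ?upd_eq // => y hy.
  by rewrite upd_neq // => e; apply: hy; exists d.
- case: s => p r w _ /= hs; split=> // [|y hy].
    by rewrite !upd_eq add0n upd_neq ?hs // => /eqP; rewrite reg_eq.
  by rewrite !upd_neq // => e; apply: hy; exists d.
- move=> /andP[w1 w2] hs; rewrite [compile_expr _ _]/= !execs_cat.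
  have [a1 b1 c1] := IH1 d s w1 hs.
  have [a2 b2 c2] := IH2 d.+1 _ w2 (agrees_above hs c1).
  case: (execs _ (execs _ s)) a2 b2 c2 => p r w a2 b2 c2.
  have -> : execs [:: (if b then Add else Defs.Sub) (reg 1 d) (reg 1 d) (reg 1 d.+1)]
     (State p r w) = State p.+1 (upd r (reg 1 d) ((if b then addn else subn)
       (r (reg 1 d)) (r (reg 1 d.+1)))) w by case: b.
  rewrite /= in a2 b2 c2 *; split; rewrite -?b1 ?upd_eq //.
    by rewrite a2 (c2 _ (@temp_not_above _)) a1.
  move=> y hy; rewrite upd_neq ?c2 ?c1 //; first by move=> /temp_aboveW.
  by move=> e'; apply: hy; exists d.
- move=> /andP[ha we] hs.
  rewrite -[compile_expr _ _]/(compile_expr e d ++ locate a d ++ _) 2!execs_cat.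
  have [a1 b1 c1] := IH d s we hs.
  have [a2 b2 c2] := execs_locate a d (execs (compile_expr e d) s).
  case: (execs _ (execs _ s)) a2 b2 c2 => p r w /= a2 b2 c2.
  split; rewrite /= -?b1 ?upd_eq //.
    rewrite a2 a1 /= c2 ?c1 ?hs //; exact: legal_not_temp.
  move=> y hy; rewrite upd_neq ?c2 ?c1 // => e'; apply: hy; by exists d.
Qed.

(* Started in a memory that agrees with [m], the code of [c] ends within [T]
   steps, just behind the code, in a memory that agrees with [sem c m]. *)
Definition implements (c : cmd) (m : memory) (T : nat) : Prop :=
  forall P d off s, code_at P off (compile c d off) ->
  agrees m (regs s) -> input s = tape m -> pc s = off ->
  exists2 t, t <= T & let s' := iter t (step P) s in
    [/\ pc s' = off + size (compile c d off), agrees (sem c m) (regs s'),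
        input s' = tape (sem c m)
      & forall j, j < d.*2 -> regs s' (reg 2 j) = regs s (reg 2 j)].

Lemma implementsW c m T T' : T <= T' -> implements c m T -> implements c m T'.
Proof.
move=> le h P d off s h1 h2 h3 h4; have [t ht hr] := h P d off s h1 h2 h3 h4.
by exists t => //; apply: leq_trans le.
Qed.

Lemma implements_seq c1 c2 m T1 T2 :
  implements c1 m T1 -> implements c2 (sem c1 m) T2 ->
  implements (Seq c1 c2) m (T1 + T2).
Proof.
move=> h1 h2 P d off s /= /code_at_cat[p1 p2] hs hi hp.
have [t1 le1 [a1 b1 c1' d1]] := h1 P d off s p1 hs hi hp.
have [t2 le2 [a2 b2 c2' d2]] := h2 P d _ _ p2 b1 c1' a1.
exists (t2 + t1); first by rewrite addnC leq_add.
rewrite iterD; split=> //; first by rewrite a2 size_cat addnA.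
by move=> j hj; rewrite d2 ?d1.
Qed.

Lemma agrees_write m r a i v :
  legal a -> agrees m r -> agrees (write m a i v) (upd r (reg a i) v).
Proof.
move=> ha h b j hb; rewrite /upd reg_eq ?legal_lt8 //=.
by case: ifP => // _; rewrite h.
Qed.

Lemma agrees_upd m r y v :
  (forall a i, legal a -> y <> reg a i) -> agrees m r -> agrees m (upd r y v).
Proof. by move=> hy h a i ha; rewrite upd_neq ?h // => /esym /hy; apply. Qed.

Lemma reg1_hidden d a i : legal a -> reg 1 d <> reg a i.
Proof. by move=> /andP[/andP[ha h1] _] /eqP; rewrite reg_eq // eq_sym (negbTE h1). Qed.

Lemma reg2_hidden d a i : legal a -> reg 2 d <> reg a i.
Proof. by move=> /andP[/andP[ha _] h1] /eqP; rewrite reg_eq // eq_sym (negbTE h1). Qed.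

Lemma implements_straight c m p :
  (forall d off, compile c d off = p) -> all straight p ->
  (forall s, agrees m (regs s) -> input s = tape m ->
     let s' := execs p s in [/\ agrees (sem c m) (regs s'),
       input s' = tape (sem c m)
     & forall j, regs s' (reg 2 j) = regs s (reg 2 j)]) ->
  implements c m (size p).
Proof.
move=> hc hp h P d off s; rewrite hc => hP hs hi hpc.
have [hr hpc'] := run_straight hP hpc hp.
by exists (size p) => //; have [] := h s hs hi; rewrite /= hr.
Qed.

Lemma implements_assign v e m :
  wf_expr e -> implements (Assign v e) m (size (compile (Assign v e) 0 0)).
Proof.
move=> we; apply: implements_straight => //.
  by rewrite all_cat straight_expr.
move=> s hs hi; rewrite execs_cat; have [a b c] := execs_expr 0 we hs.
have hs1 := agrees_above hs c.
case: (execs _ s) a b c hs1 => p r w a b c hs1; split.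
- have -> : regs (execs [:: Const (reg 0 v) 0;
       Add (reg 0 v) (reg 0 v) (reg 1 0)] (State p r w))
     = upd (upd r (reg 0 v) 0) (reg 0 v) (eval m e).
    by rewrite -a /= upd_eq upd_neq // => /eqP; rewrite reg_eq.
  move=> x i hx; rewrite (agrees_write _ _ _ (agrees_write _ _ _ hs1)) //=.
  by case: ifP => // ->.
- by rewrite /= -hi.
- move=> j; rewrite /= !upd_neq; try by move=> /eqP; rewrite reg_eq.
  exact/c/loop_not_temp.
Qed.

Lemma implements_put a e1 e2 m :
  legal a -> wf_expr e1 -> wf_expr e2 ->
  implements (Put a e1 e2) m (size (compile (Put a e1 e2) 0 0)).
Proof.
move=> ha w1 w2; apply: implements_straight => //.
  by rewrite !all_cat !straight_expr.
move=> s hs hi; rewrite 3!execs_cat.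
have [a1 b1 c1] := execs_expr 0 w1 hs.
have hs1 := agrees_above hs c1.
have [a2 b2 c2] := execs_locate a 0 (execs (compile_expr e1 0) s).
have hs2 := agrees_above hs1 c2.
have [a3 b3 c3] := execs_expr 1 w2 hs2.
have hs3 := agrees_above hs2 c3.
have a4 := c3 _ (@temp_not_above _).
case: (execs _ (execs _ (execs _ s))) a3 b3 c3 hs3 a4 => p r w /= a3 b3 c3 hs3 a4.
have -> : r (reg 1 0) = reg a (eval m e1) by rewrite a4 a2 a1.
split; first by rewrite a3; exact: agrees_write.
- by rewrite b3 b2 b1.
- move=> j; rewrite upd_neq; last exact: reg2_hidden.
  by rewrite c3 ?c2 ?c1 //; exact: loop_not_temp.
Qed.

Lemma implements_input v m : implements (Input v) m 1.
Proof.
apply: (@implements_straight (Input v) m [:: Read (reg 0 v)]) => // -[p r w] /= hs hi.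
split; first by rewrite hi; exact: (@agrees_write (Memory (cell m) _)).
- by rewrite hi.
- by move=> j; rewrite upd_neq // => /eqP; rewrite reg_eq.
Qed.

Lemma implements_if e c m T :
  wf_expr e -> implements c m T ->
  implements (If e c) m (size (compile_expr e 0) + 3 + T).
Proof.
move=> we hc P d off s /= /code_at_cat[hP1 hP2] hs hi hp.
have [r1 p1] := run_straight hP1 hp (straight_expr e 0).
have [a1 b1 c1] := execs_expr 0 we hs.
have hs1 := agrees_above hs c1.
set n := size _ in r1 p1 *; set q := compile c _ _ in hP2 *.
set s1 := execs _ _ in r1 p1 a1 b1 c1 hs1.
have [hJ hP3] := @code_at_cat _ _ [:: _; _; _] _ hP2.
have s2E := code_at_step hJ p1.
have sz : off + (n + (size q).+3) = off + n + 3 + size q by lia.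
case: ltnP => hv.
  have [|||t le [a b c' d']] := hc P d (off + n + 3) (step P s1) hP3.
  - by rewrite s2E; case: (s1) hs1.
  - by rewrite s2E -hi -b1; case: (s1).
  - by rewrite s2E; case: (s1) a1 => p r w /= ->; rewrite hv.
  exists (t + 1 + n); first by lia.
  rewrite iterD r1 iterD /=; split=> //; first by rewrite a size_cat /= sz.
  move=> j hj; rewrite d' // s2E.
  by rewrite -(c1 _ (@loop_not_temp _ _)); case: (s1).
have hs2 : step P s1 = State (off + n).+1 (regs s1) (input s1).
  rewrite s2E; case: (s1) a1 p1 => p r w /= -> ->.
  by rewrite ltnNge hv.
have [_ hJ2] := @code_at_cat _ _ [:: _] _ hJ.
have [_ hJ3] := @code_at_cat _ _ [:: _] _ hJ2.
exists (3 + n); first by lia.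
rewrite iterD r1 /= hs2 (@code_at_step _ _ _ _ (State _ _ _) hJ2) /=;
  last by rewrite addn1.
rewrite (@code_at_step _ _ _ _ (State _ _ _) hJ3) /=; last by rewrite !addn1.
split=> //; first by rewrite size_cat /= sz.
- by apply: agrees_upd => // x i hx; exact: reg1_hidden.
- by rewrite b1.
- move=> j _; rewrite upd_neq ?c1 //; first exact: loop_not_temp.
  by move=> /eqP; rewrite reg_eq.
Qed.

(** The 7 steps are four initializations and the three instructions of the final test. Apart from
    its body, a round takes 6 steps: the successful test, three instructions that set the counter
    and decrease [h], and two that jump back. *)
Lemma implements_for i v c m T :
  (forall n, n < cell m 0 v ->
     implements c (write (foldl (fun m j => sem c (write m 0 i j)) m (iota 0 n))
                     0 i n) T) ->
  implements (For i v c) m (7 + cell m 0 v * (6 + T)).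
Proof.
move=> hc P d off s; set h := reg 2 d.*2; set g := reg 2 d.*2.+1.
set t := reg 1 0; set q := compile c d.+1 (off + 10).
set N := cell m 0 v.
pose F n := foldl (fun m j => sem c (write m 0 i j)) m (iota 0 n).
move=> hP hs hi hp.
have [hP1 hP3 hP5 hP7 hP8] : [/\
    code_at P off [:: Const h 0; Add h h (reg 0 v); Const g 0; Add g g (reg 0 v)],
    code_at P (off + 4)
      [:: Jump h (off + 7); Const t 1; Jump t (off + 10 + size q + 2)],
    code_at P (off + 7) [:: Defs.Sub (reg 0 i) g h; Const t 1; Defs.Sub h h t],
    code_at P (off + 10) q
  & code_at P (off + 10 + size q) [:: Const t 1; Jump t (off + 4)]].
  have [h1 /code_at_cat[h2 /code_at_cat[h3 /code_at_cat[h4 h5]]]] := code_at_cat hP.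
  by rewrite -!addnA in h2 h3 h4 h5; rewrite -!addnA; split.
have [r1 p1] := run_straight hP1 hp isT.
have loop n : n <= N -> exists2 t, t <= 4 + n * (6 + T) &
  let s' := iter t (step P) s in
  [/\ pc s' = off + 4, agrees (F n) (regs s'),
      input s' = tape (F n),
      regs s' h = N - n /\ regs s' g = N
    & forall j, j < d.*2 -> regs s' (reg 2 j) = regs s (reg 2 j)].
  elim: n => [_|n IH hn].
    exists 4 => //; rewrite r1; split=> //; try by case: (s) hi hp.
    - case: (s) hs => p r w /= hr.
      by do 4![apply: agrees_upd; first by move=> a x; exact: reg2_hidden].
    - case: (s) hs => p r w /= hr.
      rewrite /upd !reg_eq //= !eqxx /= (ltn_eqF (ltnSn _)).
      by rewrite /= subn0 !hr.
    - move=> j hj; case: (s) => p r w /=.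
      rewrite !upd_neq //; by move=> /eqP; rewrite reg_eq //= => /eqP; lia.
  have [t1 le1 [a1 b1 c1 [d1 e1] f1]] := IH (ltnW hn).
  set s1 := iter t1 _ _ in a1 b1 c1 d1 e1 f1.
  have s2E : step P s1 = State (off + 7) (regs s1) (input s1).
    rewrite (code_at_step hP3) //; case: (s1) d1 => p r w /= ->.
    by rewrite subn_gt0 hn.
  have [] := @run_straight P (off + 7) _ (State (off + 7) (regs s1) (input s1)) hP5 _ isT => //.
  set s3 := execs _ _ => r3 p3.
  have s3E : s3 = State (off + 10)
      (upd (upd (upd (regs s1) (reg 0 i) n) t 1) h (N - n.+1)) (input s1).
    rewrite /s3 /= e1 d1 !upd_eq upd_neq; last by move=> /eqP; rewrite reg_eq.
    rewrite upd_neq; last by move=> /eqP; rewrite reg_eq.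
    by rewrite d1 subKn ?(ltnW hn) // subn1 -subnS -!addnS.
  have [||||t4 le4 [a4 b4 c4 d4]] := hc n hn P d.+1 (off + 10) s3.
  - exact: hP7.
  - rewrite s3E /=; apply: agrees_upd; first by move=> a x; exact: reg2_hidden.
    apply: agrees_upd; first by move=> a x; exact: reg1_hidden.
    exact: agrees_write.
  - by rewrite s3E.
  - by rewrite s3E.
  set s4 := iter t4 _ _ in a4 b4 c4 d4.
  have [_ hP9] := @code_at_cat _ _ [:: _] _ hP8.
  have s5E : step P (step P s4) = State (off + 4) (upd (regs s4) t 1) (input s4).
    rewrite (code_at_step hP8 a4); case: (s4) a4 => p r w /= ->.
    rewrite (@code_at_step _ _ _ _ (State _ _ _) hP9) /=; last by rewrite addn1.
    by rewrite ?upd_eq.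
  exists (2 + t4 + 3 + 1 + t1).
    rewrite mulSn; lia.
  rewrite 4!iterD -/s1 [iter 1 _ _]/= s2E r3 -/s4 [iter 2 _ _]/= s5E /=.
  have FE : F n.+1 = sem c (write (F n) 0 i n).
    by rewrite /F -[n.+1 in LHS]addn1 iotaD foldl_cat.
  rewrite FE; split=> //.
  - by apply: agrees_upd => // a x; exact: reg1_hidden.
  - have neq1 j : reg 2 j <> t by move=> /eqP; rewrite reg_eq.
    have neq2 j : j < d.*2.+2 -> regs s4 (reg 2 j) = regs s3 (reg 2 j).
      by move=> hj; rewrite d4.
    rewrite /h /g !upd_neq // !neq2 // s3E /= upd_eq !upd_neq ?e1 //.
    + by move=> /eqP; rewrite reg_eq.
    + by move=> /eqP; rewrite reg_eq //= => /eqP; lia.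
  - move=> j hj; rewrite upd_neq; last by move=> /eqP; rewrite reg_eq.
    rewrite d4 ?s3E /= ?upd_neq ?f1 //; first by move=> /eqP; rewrite reg_eq.
    + by move=> /eqP; rewrite reg_eq.
    + by move=> /eqP; rewrite reg_eq //= => /eqP; lia.
    + by lia.
have [t1 le1 [a1 b1 c1 [d1 e1] f1]] := loop N (leqnn N).
set s1 := iter t1 _ _ in a1 b1 c1 d1 e1 f1.
exists (3 + t1); first by lia.
rewrite iterD -/s1 /= (code_at_step hP3 a1).
have [_ hP9] := @code_at_cat _ _ [:: _] _ hP3.
have [_ hP10] := @code_at_cat _ _ [:: _] _ hP9.
case: (s1) a1 b1 c1 d1 e1 f1 => p r w /= -> b1 c1 -> e1 f1.
rewrite subnn ltnn.
rewrite (@code_at_step _ _ _ _ (State _ _ _) hP9) /=; last by rewrite addn1.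
rewrite (@code_at_step _ _ _ _ (State _ _ _) hP10) /=; last by rewrite !addn1.
split=> //.
- by rewrite size_cat /= -/q; lia.
- by apply: agrees_upd => // a x; exact: reg1_hidden.
- move=> j hj; rewrite upd_neq ?f1 //; by move=> /eqP; rewrite reg_eq.
Qed.

(* Bounds the running time when each loop bound [v] never exceeds [b v]. *)
Fixpoint cost (b : nat -> nat) (c : cmd) : nat :=
  match c with
  | Assign _ _ | Put _ _ _ | Input _ => size (compile c 0 0)
  | Seq c1 c2 => cost b c1 + cost b c2
  | If e c => size (compile_expr e 0) + 3 + cost b c
  | For _ v c => 7 + b v * (6 + cost b c)
  end.

Fixpoint loop_bounds (c : cmd) : seq nat :=
  match c with
  | Assign _ _ | Put _ _ _ | Input _ => [::]
  | Seq c1 c2 => loop_bounds c1 ++ loop_bounds c2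
  | If e c => loop_bounds c
  | For _ v c => v :: loop_bounds c
  end.

(** Ensures that each loop still finds the initial value of its bound, so that [cost] may be
    evaluated at the initial memory. Inside a loop, the body and the counter must both spare the
    inner bounds, because later rounds run the inner loops again. *)
Fixpoint constant_bounds (c : cmd) : bool :=
  match c with
  | Assign _ _ | Put _ _ _ | Input _ => true
  | Seq c1 c2 => [&& constant_bounds c1, constant_bounds c2
                   & all (fun v => ~~ touches c1 0 v) (loop_bounds c2)]
  | If e c => constant_bounds c
  | For i v c' => constant_bounds c'
                  && all (fun w => ~~ touches c 0 w) (loop_bounds c')
  end.

Lemma implements_cost b c m :
  wf c -> constant_bounds c -> all (fun v => cell m 0 v <= b v) (loop_bounds c) ->
  implements c m (cost b c).
Proof.
elim: c m => [v e|a e1 e2|v|c1 IH1 c2 IH2|e c IH|i v c IH] m.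
- by move=> we _ _; exact: implements_assign.
- by case/and3P => *; exact: implements_put.
- by move=> *; exact: implements_input.
- move=> /andP[w1 w2] /and3P[s1 s2 s3] /=; rewrite all_cat => /andP[b1 b2].
  apply: implements_seq; first exact: IH1.
  apply: IH2 => //; apply/allP => v hv; rewrite sem_frame ?(allP b2) //.
  exact: (allP s3).
- by move=> /andP[we wc] sc bc; apply: implements_if => //; exact: IH.
- move=> /= wc /andP[sc /allP st] /andP[bv /allP bc].
  apply: (@implementsW _ _ (7 + cell m 0 v * (6 + cost b c))).
    by rewrite leq_add2l leq_mul2r bv orbT.
  apply: implements_for => n hn; apply: IH => //; apply/allP => w hw.
  have := st _ hw; rewrite negb_or => /andP[/= /negbTE -> ht].
  apply: leq_trans (bc _ hw).
  elim: (iota 0 n) (m) => //= j s IHs m'; apply: leq_trans (IHs _) _.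
  by rewrite sem_frame //=; have := st _ hw; rewrite negb_or => /andP[/negbTE ->].
Qed.

Definition start (w : seq nat) : memory := Memory (fun _ _ => 0) w.

Lemma implements_outputs c w T T' :
  implements c (start w) T -> T <= T' ->
  outputs_within (compile c 0 0) w T' (cell (sem c (start w)) 0 0).
Proof.
move=> hc le.
have [||||t le' [a b _ _]] := hc (compile c 0 0) 0 0 (init w) => //.
  by exists [::], [::]; rewrite cats0.
have halt n s : halted (compile c 0 0) s -> iter n (step (compile c 0 0)) s = s.
  move=> hs; elim: n => //= n ->; rewrite /step.
  by rewrite onthE nth_default // size_map.
have ht : halted (compile c 0 0) (run (compile c 0 0) w t).
  by rewrite /halted /run a.
have hr : run (compile c 0 0) w T' = run (compile c 0 0) w t.
  by rewrite /run -(subnK (leq_trans le' le)) iterD halt.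
by rewrite /outputs_within hr; split=> //; exact: (b 0 0 isT).
Qed.

(** * The decision program *)

(** The frame property is handed to every round: cells that the loop does not touch have their
    values from before the loop, so [I] only has to describe what changes. *)
Lemma for_ind (I : nat -> memory -> Prop) i v c m n :
  cell m 0 v = n -> I 0 m ->
  (forall j m', j < n ->
     (forall a x, ~~ touches (For i v c) a x -> cell m' a x = cell m a x) ->
     I j m' -> I j.+1 (sem c (write m' 0 i j))) ->
  I n (sem (For i v c) m).
Proof.
move=> hv I0 IS /=; rewrite hv.
pose F n := foldl (fun m j => sem c (write m 0 i j)) m (iota 0 n).
suff h j : j <= n -> I j (F j) /\ forall a x, ~~ touches (For i v c) a x ->
    cell (F j) a x = cell m a x by case: (h n).
elim: j => [|j IH] hj; first by [].
have [h1 h2] := IH (ltnW hj).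
have -> : F j.+1 = sem c (write (F j) 0 i j).
  by rewrite /F -[j.+1 in LHS]addn1 iotaD foldl_cat.
split=> [|a x h]; first exact: IS.
rewrite -h2 // sem_frame /=; move: h; rewrite /= negb_or => /andP[/negbTE] //.
by move=> ->.
Qed.

Definition pairs (n : nat) : seq (nat * nat) :=
  [seq (i, j) | i <- iota 0 n, j <- iota 0 n].

(** The invariant speaks of the list of pairs treated so far, which lets results be stated as counts
    and folds over [pairs n]. The hypothesis about [m1] and [m2] makes it blind to the two counters,
    which the loops overwrite between runs of the body. *)
Lemma for2_ind (I : seq (nat * nat) -> memory -> Prop) (i j : nat) v c m n :
  i != j -> ~~ touches c 0 i -> ~~ touches (For i v (For j v c)) 0 v ->
  cell m 0 v = n ->
  (forall p m1 m2, (forall a x, ~~ ((a == 0) && ((x == i) || (x == j))) ->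
     cell m2 a x = cell m1 a x) -> I p m1 -> I p m2) ->
  I [::] m ->
  (forall p a b m', a < n -> b < n ->
     (forall a x, ~~ touches (For i v (For j v c)) a x ->
        cell m' a x = cell m a x) ->
     cell m' 0 i = a -> cell m' 0 j = b ->
     I p m' -> I (rcons p (a, b)) (sem c m')) ->
  I (pairs n) (sem (For i v (For j v c)) m).
Proof.
move=> ij ci hv hn irr I0 IS.
pose row (a b : nat) := [seq (a, x) | x <- iota 0 b].
pose rows a := [seq (x, y) | x <- iota 0 a, y <- iota 0 n].
apply: (@for_ind (fun a m => I (rows a) m) i v (For j v c)) => // a m1 ha h1 I1.
have nE : cell (write m1 0 i a) 0 v = n.
  rewrite /=; case: eqP => [e|_]; last by rewrite h1.
  by move: hv; rewrite /= e eqxx.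
have -> : rows a.+1 = rows a ++ row a n.
  by rewrite /rows -[a.+1]addn1 iotaD allpairs_cat /= cats0.
apply: (@for_ind (fun b m => I (rows a ++ row a b) m) j v c) => //.
  rewrite cats0; apply: irr I1 => b x /=.
  by case: (b == 0) => //=; rewrite negb_or => /andP[/negbTE ->].
move=> b m2 hb h2 I2.
have -> : rows a ++ row a b.+1 = rcons (rows a ++ row a b) (a, b).
  by rewrite /row -[b.+1]addn1 iotaD map_cat /= -cats1 catA.
apply: IS => //.
- move=> d x /= hd; move: (hd); rewrite orbA negb_or => /andP[hd1 hd2].
  move: hd1; rewrite negb_or => /andP[/negbTE hd1 /negbTE hd3]; rewrite hd3.
  rewrite h2 /= ?hd1 ?hd3 ?(negbTE hd2) // h1 //=.
- by rewrite /= (negbTE ij) h2 /= ?eqxx // (negbTE ij) (negbTE ci).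
- by rewrite /= eqxx.
- apply: irr I2 => d x /=.
  by case: (d == 0) => //=; rewrite negb_or => /andP[_ /negbTE ->].
Qed.

Coercion Var : nat >-> expr.

Notation "e +! f" := (Bin true e f) (at level 50, left associativity).
Notation "e -! f" := (Bin false e f) (at level 50, left associativity).
Notation "c ;; d" := (Seq c d) (at level 90, right associativity).
Notation neq e f := ((e -! f) +! (f -! e)).

(* [rL] is the length of the word, [rs] becomes [n * n], [rp] is the unread part
   of the guess [rq].  The arrays are the word ([aX]), the multiples of [n]
   ([aR]), the numbers of forbidden edges at the vertices ([aT]), the indicator
   of the kept pairs ([aK]), and that of the vertices met by the guess ([aU]). *)
Notation rans := 0.
Notation rk := 1.
Notation rL := 2.
Notation rn := 3.
Notation rN := 4.
Notation rq := 5.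
Notation ri := 6.
Notation rj := 7.
Notation rs := 8.
Notation rok := 9.
Notation rcnt := 10.
Notation rc := 11.
Notation rp := 12.
Notation rgood := 13.
Notation rw := 14.
Notation rsq := 15.
Notation aX := 3.
Notation aR := 4.
Notation aT := 5.
Notation aK := 6.
Notation aU := 7.

Definition Ebit (i j : expr) : expr := Get aX (Get aR i +! j).
Definition Ubit (i j : expr) : expr := Get aX (rs +! (Get aR i +! j)).
Definition Fbit (i j : expr) : expr := Ebit i j -! Ubit i j.

Definition set_power (d : nat) : cmd :=
  Assign rw (rk +! rk +! rk +! rk);;
  Assign rN (Lit d);;
  For ri rw (For rj rw (Assign rN (rN +! rN))).

Definition read_word : cmd := For ri rL (Input rp;; Put aX ri rp).

(** [rsq] runs through the numbers 2(i+1)^2, whose successive differences are 4i+2; this avoids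
    multiplication. *)
Definition find_order : cmd :=
  Assign rsq (Lit 0);;
  Assign rn (Lit 0);;
  For ri rL (Assign rsq (rsq +! (ri +! ri +! ri +! ri +! Lit 2));;
             Assign rn (rn +! (Lit 1 -! (rsq -! rL)))).

Definition set_rows : cmd :=
  Assign rs (Lit 0);;
  For ri rn (Put aR ri rs;; Assign rs (rs +! rn));;
  Assign rok (Lit 1 -! neq (rs +! rs) rL).

(* Flags are 0 or 1, so that subtracting a sum of defects, cut off at 0, is a
   conjunction; this replaces most tests below. *)
Definition validate : cmd :=
  Assign rcnt (Lit 0);;
  For ri rn (For rj rn (
    Assign rok (rok -! (neq (Ebit ri rj) (Ebit rj ri)
                        +! neq (Ubit ri rj) (Ubit rj ri)
                        +! (Ubit ri rj -! Ebit ri rj)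
                        +! (Ebit ri rj -! neq ri rj)));;
    Put aT ri (Get aT ri +! Fbit ri rj);;
    Assign rcnt (rcnt +! Fbit ri rj))).

Definition set_kept : cmd :=
  For ri rn (
    Assign rc (Lit 0);;
    For rj rn (
      Put aK (Get aR ri +! rj)
        (Lit 1 -! ((Lit 1 -! Get aT ri) +! (Lit 1 -! Ubit ri rj)
                   +! ((Lit 1 -! Get aT rj) -! ((rk +! rk) -! rc))));;
      Assign rc (rc +! (Ubit ri rj -! Get aT rj)))).

(** The mark of [ri] is set before that of [rj] is tested, so that a selected pair with equal
    entries spoils the guess as well. *)
Definition select_arcs : cmd :=
  For ri rn (For rj rn (
    If (Get aK (Get aR ri +! rj)) (
      Assign rp (rp +! rp);;
      If (Lit 1 -! (rN -! rp)) (
        Assign rp (rp -! rN);;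
        Assign rgood (rgood -! Get aU ri);;
        Put aU ri (Lit 1);;
        Assign rgood (rgood -! Get aU rj);;
        Put aU rj (Lit 1))))).

Definition check_cover : cmd :=
  For ri rn (For rj rn (
    Assign rgood (rgood -! (Fbit ri rj -! (Get aU ri +! Get aU rj))))).

Definition guess : cmd :=
  For rq rN (
    Assign rgood (Lit 1);;
    Assign rp rq;;
    For ri rn (Put aU ri (Lit 0));;
    select_arcs;;
    check_cover;;
    Assign rans (rans +! rgood)).

Definition answer : cmd :=
  Assign rans (Lit 1 -! ((Lit 1 -! rans) +! (Lit 1 -! rok)
                         +! neq rcnt (rk +! rk))).

(** * The boolean function computed by the program *)

Definition is_edge (x : seq bool) (n i j : nat) : bool := nth false x (i * n + j).

Definition is_allowed (x : seq bool) (n i j : nat) : bool :=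
  nth false x (n * n + (i * n + j)).

Definition is_forbidden (x : seq bool) (n : nat) (e : nat * nat) : bool :=
  is_edge x n e.1 e.2 && ~~ is_allowed x n e.1 e.2.

Definition valid (x : seq bool) (n : nat) (e : nat * nat) : bool :=
  [&& is_edge x n e.1 e.2 == is_edge x n e.2 e.1,
      is_allowed x n e.1 e.2 == is_allowed x n e.2 e.1,
      is_allowed x n e.1 e.2 ==> is_edge x n e.1 e.2
    & is_edge x n e.1 e.2 ==> (e.1 != e.2)].

Definition terminal (x : seq bool) (n i : nat) : bool :=
  has (fun j => is_forbidden x n (i, j)) (iota 0 n).

Definition rank (x : seq bool) (n i j : nat) : nat :=
  count (fun j' => is_allowed x n i j' && ~~ terminal x n j') (iota 0 j).

Definition kept (x : seq bool) (n k : nat) (e : nat * nat) : bool :=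
  [&& terminal x n e.1, is_allowed x n e.1 e.2
    & terminal x n e.2 || (rank x n e.1 e.2 < k + k)].

(* The guess [q < N] is read as a bit string, most significant bit first, one
   bit for every pair in [K]. *)
Definition select_step (N : nat) (K : pred (nat * nat))
    (st : nat * seq (nat * nat)) (e : nat * nat) : nat * seq (nat * nat) :=
  if K e then
    if N <= st.1 + st.1 then (st.1 + st.1 - N, rcons st.2 e)
    else (st.1 + st.1, st.2)
  else st.

Definition select (N : nat) (K : pred (nat * nat)) (q : nat)
    (s : seq (nat * nat)) : nat * seq (nat * nat) :=
  foldl (select_step N K) (q, [::]) s.

Definition ends (T : Type) (l : seq (T * T)) : seq T :=
  flatten [seq [:: e.1; e.2] | e <- l].

Definition good (x : seq bool) (n : nat) (l : seq (nat * nat)) : bool :=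
  uniq (ends l) && all (fun e => is_forbidden x n e ==>
                         (e.1 \in ends l) || (e.2 \in ends l)) (pairs n).

(** The integer part of the square root of L/2. *)
Definition order_of (L : nat) : nat :=
  count (fun i => i.+1 * i.+1 + i.+1 * i.+1 <= L) (iota 0 L).

Definition width (k : nat) : nat := (k + k + k + k) * (k + k + k + k).

Definition accept (x : seq bool) (k : nat) : bool :=
  let n := order_of (size x) in
  let N := 2 ^ width k in
  [&& n * n + n * n == size x, all (valid x n) (pairs n),
      count (is_forbidden x n) (pairs n) == k + k
    & has (fun q => good x n (select N (kept x n k) q (pairs n)).2) (iota 0 N)].

(** * Specifications of the stages of the program *)

Lemma ends_rcons (T : Type) (l : seq (T * T)) e :
  ends (rcons l e) = ends l ++ [:: e.1; e.2].
Proof. by rewrite /ends map_rcons -cats1 flatten_cat. Qed.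

Lemma sem_seq c1 c2 m : sem (c1;; c2) m = sem c2 (sem c1 m).
Proof. by []. Qed.

Lemma set_power_spec d m :
  cell (sem (set_power d) m) 0 rN = d * 2 ^ width (cell m 0 rk).
Proof.
rewrite /set_power !sem_seq; set m1 := sem (Assign _ _) (sem _ m).
have -> : width (cell m 0 rk) = size (pairs (cell m1 0 rw)).
  by rewrite size_allpairs size_iota.
apply: (@for2_ind (fun p m => cell m 0 rN = d * 2 ^ size p)) => //.
- by move=> p m2 m3 h <-; rewrite h.
- by rewrite /= muln1.
- move=> p a b m' _ _ _ _ _ /= ->; rewrite size_rcons expnS; lia.
Qed.

Lemma read_word_spec m w :
  cell m 0 rL = size w -> tape m = w -> (forall p, cell m aX p = 0) ->
  forall p, cell (sem read_word m) aX p = nth 0 w p.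
Proof.
move=> hL hw h0.
suff [h _] : (forall p, cell (sem read_word m) aX p
                 = if p < cell m 0 rL then nth 0 w p else 0)
    /\ tape (sem read_word m) = drop (cell m 0 rL) w.
  by move=> p; rewrite h hL; case: ltnP => // /(nth_default 0) ->.
apply: (@for_ind (fun n m => (forall p, cell m aX p
   = if p < n then nth 0 w p else 0) /\ tape m = drop n w)) => //; first by rewrite drop0.
move=> j m' hj _ [h1 h2] /=; rewrite h2; split=> [p|].
  by rewrite ltnS leq_eqVlt h1; case: eqP => [->|//]; rewrite -nth0 nth_drop addn0.
by rewrite -drop1 drop_drop add1n.
Qed.

Lemma find_order_spec m :
  cell (sem find_order m) 0 rn = order_of (cell m 0 rL).
Proof.
rewrite /find_order !sem_seq; set m1 := sem (Assign _ _) (sem _ m).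
set body := For _ _ _.
suff [h _] : cell (sem body m1) 0 rn = order_of (cell m 0 rL)
    /\ cell (sem body m1) 0 rsq
      = cell m 0 rL * cell m 0 rL + cell m 0 rL * cell m 0 rL by exact: h.
apply: (@for_ind (fun j m' => cell m' 0 rn = count
   (fun i => i.+1 * i.+1 + i.+1 * i.+1 <= cell m 0 rL) (iota 0 j)
   /\ cell m' 0 rsq = j * j + j * j) ri rL _ m1) => // j m' _ h [h1 h2].
have hL : cell m' 0 rL = cell m 0 rL by rewrite h.
rewrite -[in iota _ _](addn1 j) iotaD count_cat.
rewrite /= h1 h2 hL; split; last by nia.
rewrite addn0 add0n; congr (_ + _).
have -> : j * j + j * j + (j + j + j + j + 2) = j.+1 * j.+1 + j.+1 * j.+1 by nia.
by move: (_ + _) => t; case: (leqP t) => /=; lia.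
Qed.

Lemma set_rows_spec m :
  let n := cell m 0 rn in let m' := sem set_rows m in
  [/\ forall i, i < n -> cell m' aR i = i * n, cell m' 0 rs = n * n
    & cell m' 0 rok = (n * n + n * n == cell m 0 rL)].
Proof.
move=> n; rewrite /set_rows !sem_seq; set m1 := sem (Assign rs _) m.
set body := For _ _ _.
have [h1 h2] : (forall i, i < n -> cell (sem body m1) aR i = i * n)
    /\ cell (sem body m1) 0 rs = n * n.
  apply: (@for_ind (fun j m => (forall i, i < j -> cell m aR i = i * n)
     /\ cell m 0 rs = j * n) ri rn _ m1) => // j m' _ h [h1 h2].
  have hn : cell m' 0 rn = n by rewrite h.
  rewrite /= h2 hn; split; last by rewrite mulSn addnC.
  by move=> i; rewrite ltnS leq_eqVlt; case: eqP => [->|_ /= /h1].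
have hL : cell (sem body m1) 0 rL = cell m 0 rL by rewrite sem_frame.
by rewrite /= h2 hL; split=> //; case: eqP; lia.
Qed.

Definition context (x : seq bool) (n : nat) (m : memory) : Prop :=
  [/\ cell m 0 rn = n, cell m 0 rs = n * n,
      forall p, cell m aX p = nth false x p
    & forall i, i < n -> cell m aR i = i * n].

Definition context_cell (a i : nat) : bool :=
  [|| (a == 0) && ((i == rn) || (i == rs)), a == aX | a == aR].

Lemma context_eq x n m m' :
  (forall a i, context_cell a i -> cell m' a i = cell m a i) ->
  context x n m -> context x n m'.
Proof. by move=> h [h1 h2 h3 h4]; split=> *; rewrite h ?h1 ?h2 ?h3 ?h4. Qed.

Lemma context_write x n m a i v :
  ~~ context_cell a i -> context x n m -> context x n (write m a i v).
Proof.
move=> h; apply: context_eq => b j hb /=; case: ifP => // /andP[/eqP eb /eqP ej].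
by rewrite eb ej (negbTE h) in hb.
Qed.

Lemma context_edge x n m i j : context x n m -> i < n ->
  cell m aX (cell m aR i + j) = is_edge x n i j.
Proof. by move=> [_ _ h3 h4] hi; rewrite h4 // h3. Qed.

Lemma context_allowed x n m i j : context x n m -> i < n ->
  cell m aX (cell m 0 rs + (cell m aR i + j)) = is_allowed x n i j.
Proof. by move=> [_ h2 h3 h4] hi; rewrite h2 h4 // h3. Qed.

Lemma validate_spec x n m (ok : bool) :
  context x n m -> cell m 0 rok = ok -> (forall i, cell m aT i = 0) ->
  let m' := sem validate m in
  [/\ cell m' 0 rok = ok && all (valid x n) (pairs n),
      forall i, i < n -> (0 < cell m' aT i) = terminal x n i
    & cell m' 0 rcnt = count (is_forbidden x n) (pairs n)].
Proof.
move=> hm hok hT; have [hn _ _ _] := hm.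
suff [h1 h2 h3] : [/\ cell (sem validate m) 0 rok = ok && all (valid x n) (pairs n),
    forall i, cell (sem validate m) aT i
      = count (fun e => (e.1 == i) && is_forbidden x n e) (pairs n)
  & cell (sem validate m) 0 rcnt = count (is_forbidden x n) (pairs n)].
  split=> // i hi; rewrite h2 -has_count; apply/hasP/hasP => -[].
    move=> _ /allpairsP[[a b] /= [_ hb ->]] /= /andP[/eqP -> hab].
    by exists b.
  move=> j hj hij; exists (i, j); last by rewrite /= eqxx.
  by apply/allpairsP; exists (i, j); rewrite mem_iota.
rewrite /validate sem_seq; set m1 := sem _ m.
apply: (@for2_ind (fun p m' => [/\ cell m' 0 rok = ok && all (valid x n) p,
    forall i, cell m' aT i = count (fun e => (e.1 == i) && is_forbidden x n e) p
  & cell m' 0 rcnt = count (is_forbidden x n) p]) ri rj rn _ m1) => //.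
- by move=> p m2 m3 h [h1 h2 h3]; split=> [|i|]; rewrite h ?h1 ?h2 ?h3.
- by rewrite /= andbT.
move=> p a b m2 ha hb hfr hi hj [h1 h2 h3].
have hm2 : context x n m2.
  by apply: context_eq hm => c i hc; rewrite hfr //;
    case/or3P: hc => [/andP[/eqP -> /orP[]/eqP ->]|/eqP ->|/eqP ->].
have E2 := context_edge _ hm2; have A2 := context_allowed _ hm2.
rewrite /= !hi !hj !E2 // !A2 // h1 h2 h3 all_rcons /valid /=; split=> [|i|].
- have -> : (a != b) = (0 < (a - b) + (b - a)) by case: (a =P b); lia.
  case: (a - b + (b - a)) => [|d]; case: (ok); case: (all _ _);
  case: (is_edge x n a b); case: (is_edge x n b a); case: (is_allowed x n a b);
  by case: (is_allowed x n b a).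
- rewrite -cats1 count_cat /= addn0 h2 [a == i]eq_sym /is_forbidden /=.
  case: eqP => [->|_]; last by rewrite addn0.
  by case: is_edge; case: is_allowed.
- rewrite -cats1 count_cat /= addn0 /is_forbidden /=.
  by case: is_edge; case: is_allowed.
Qed.

Lemma set_kept_spec x n k m :
  context x n m -> cell m 0 rk = k ->
  (forall i, i < n -> (0 < cell m aT i) = terminal x n i) ->
  forall i j, i < n -> j < n ->
  cell (sem set_kept m) aK (i * n + j) = kept x n k (i, j).
Proof.
move=> hm hk hT; have [hn _ _ _] := hm.
(* Different pairs have different cells, so writing one of them preserves the finished ones. *)
have inj i j a b : j < n -> b < n -> i * n + j = a * n + b -> i = a /\ j = b.
  move=> hj hb e; have hn0 : 0 < n by exact: leq_ltn_trans hj.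
  have := congr1 (divn^~ n) e; have := congr1 (modn^~ n) e.
  by rewrite /= !modnMDl !divnMDl // !modn_small // !divn_small // !addn0.
apply: (@for_ind (fun a m => forall i j, i < a -> j < n ->
   cell m aK (i * n + j) = kept x n k (i, j)) ri rn _ m) => // a m1 ha hfr1 h1.
rewrite sem_seq; set m2 := sem (Assign _ _) _.
have hm2 : context x n m2.
  rewrite /m2 /=; apply: context_write => //; apply: context_write => //.
  by apply: context_eq hm => c i hc; rewrite hfr1 //;
    case/or3P: hc => [/andP[/eqP -> /orP[]/eqP ->]|/eqP ->|/eqP ->].
have [hn2 _ _ _] := hm2.
have hT2 i : cell m2 aT i = cell m aT i by rewrite -hfr1.
have hk2 : cell m2 0 rk = k by rewrite -hk -hfr1.
pose I b m' := [/\ forall i j, i < a -> j < n ->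
     cell m' aK (i * n + j) = kept x n k (i, j),
   forall j, j < b -> cell m' aK (a * n + j) = kept x n k (a, j)
 & cell m' 0 rc = rank x n a b].
suff [h2 h3 _] : I n (sem (For rj rn (Put aK (Get aR ri +! rj)
        (Lit 1 -! ((Lit 1 -! Get aT ri) +! (Lit 1 -! Ubit ri rj)
                   +! ((Lit 1 -! Get aT rj) -! ((rk +! rk) -! rc))));;
      Assign rc (rc +! (Ubit ri rj -! Get aT rj)))) m2).
  by move=> i j; rewrite ltnS leq_eqVlt => /orP[/eqP ->|]; [exact: h3|exact: h2].
apply: for_ind => //.
move=> b m3 hb hfr3 [h2 h3 h4].
have hm3 : context x n m3.
  by apply: context_eq hm2 => c i hc; rewrite hfr3 //;
    case/or3P: hc => [/andP[/eqP -> /orP[]/eqP ->]|/eqP ->|/eqP ->].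
have hT3 i : i < n -> (0 < cell m3 aT i) = terminal x n i.
  by move=> hi; rewrite hfr3 // hT2 hT.
have hk3 : cell m3 0 rk = k by rewrite hfr3.
have hi3 : cell m3 0 ri = a by rewrite hfr3.
have [_ _ _ hR] := hm3.
have rankS : rank x n a b.+1
    = rank x n a b + (is_allowed x n a b && ~~ terminal x n b).
  by rewrite /rank -[in LHS](addn1 b) iotaD count_cat /= addn0.
have val : 1 - (1 - cell m3 aT a + (1 - is_allowed x n a b)
      + (1 - cell m3 aT b - (k + k - rank x n a b))) = kept x n k (a, b).
  rewrite /kept /= -?hT3 //; case: is_allowed; last by rewrite andbF; lia.
  by case: (cell m3 aT a); case: (cell m3 aT b); lia.
rewrite /I /= hi3 h4 hk3 (context_allowed _ hm3) // hR // val; split.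
- move=> i j hi hj; case: eqP => [/inj|_]; last exact: h2.
  by case=> // e _; rewrite e ltnn in hi.
- move=> j; rewrite ltnS leq_eqVlt => /orP[/eqP ->|hj]; first by rewrite eqxx.
  by case: eqP => [/addnI ->|_] //; exact: h3.
- by rewrite rankS -hT3 //; congr (_ + _); case: is_allowed; case: (cell m3 aT b).
Qed.

Lemma select_arcs_spec x n (K : pred (nat * nat)) N q m :
  context x n m -> (forall i j, i < n -> j < n -> cell m aK (i * n + j) = K (i, j)) ->
  cell m 0 rN = N -> cell m 0 rp = q -> cell m 0 rgood = 1 ->
  (forall i, i < n -> cell m aU i = 0) ->
  let l := (select N K q (pairs n)).2 in let m' := sem select_arcs m in
  cell m' 0 rgood = uniq (ends l)
  /\ forall i, i < n -> cell m' aU i = (i \in ends l).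
Proof.
move=> hm hK hN hq hg hU l m'; have [hn _ _ _] := hm.
pose I s m' := let st := select N K q s in
  [/\ cell m' 0 rp = st.1, cell m' 0 rgood = uniq (ends st.2)
    & forall i, i < n -> cell m' aU i = (i \in ends st.2)].
suff [] : I (pairs n) m' by [].
apply: for2_ind => //.
- by move=> p m1 m2 h [h1 h2 h3]; split=> [||i hi]; rewrite h ?h1 ?h2 ?h3.
move=> p a b m1 ha hb hfr hi hj [h1 h2 h3].
have hm1 : context x n m1.
  by apply: context_eq hm => c i hc; rewrite hfr //;
    case/or3P: hc => [/andP[/eqP -> /orP[]/eqP ->]|/eqP ->|/eqP ->].
have [_ _ _ hR] := hm1.
have hN1 : cell m1 0 rN = N by rewrite hfr.
have hK1 : cell m1 aK (a * n + b) = K (a, b) by rewrite hfr // hK.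
have selE : select N K q (rcons p (a, b)) = select_step N K (select N K q p) (a, b).
  by rewrite /select -cats1 foldl_cat.
rewrite /I selE /select_step; move: (select N K q p) h1 h2 h3 => st h1 h2 h3.
rewrite [sem _ _]/= hi hj hR // hK1; case: (K (a, b)) => /=; last by split.
rewrite h1 hN1; have -> : (0 < 1 - (N - (st.1 + st.1))) = (N <= st.1 + st.1) by lia.
case: leqP => _; last by split.
have -> : uniq (ends (rcons st.2 (a, b)))
    = [&& uniq (ends st.2), a \notin ends st.2, b != a & b \notin ends st.2].
  rewrite ends_rcons cat_uniq /= mem_seq1 orbF negb_or andbT eq_sym.
  by case: (uniq _) => //=; rewrite -andbA; congr (_ && _); rewrite andbC.
split=> // [|i hi'].
  rewrite h2 !h3 //; case: (uniq _) => //=; case: (a \in _) => //=.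
  by case: (b == a) => //=; case: (b \in _).
have -> : (i \in ends (rcons st.2 (a, b)))
    = [|| i \in ends st.2, i == a | i == b] by rewrite ends_rcons mem_cat !inE.
rewrite /=; case: ifP => _; first by rewrite !orbT.
by case: ifP => _; rewrite ?orbT ?orbF ?h3.
Qed.

Lemma check_cover_spec x n m (g : bool) (U : pred nat) :
  context x n m -> cell m 0 rgood = g ->
  (forall i, i < n -> cell m aU i = U i) ->
  cell (sem check_cover m) 0 rgood
    = g && all (fun e => is_forbidden x n e ==> U e.1 || U e.2) (pairs n).
Proof.
move=> hm hg hU; have [hn _ _ _] := hm.
apply: (@for2_ind (fun p m => cell m 0 rgood
    = g && all (fun e => is_forbidden x n e ==> U e.1 || U e.2) p)) => //.
- by move=> p m1 m2 h <-; rewrite h.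
- by rewrite /= andbT.
move=> p a b m1 ha hb hfr hi hj h1.
have hm1 : context x n m1.
  by apply: context_eq hm => c i hc; rewrite hfr //;
    case/or3P: hc => [/andP[/eqP -> /orP[]/eqP ->]|/eqP ->|/eqP ->].
rewrite /= hi hj h1 (context_edge _ hm1) // (context_allowed _ hm1) //.
rewrite !hfr // !hU // all_rcons /is_forbidden /=.
case: g {hg h1}; case: (all _ _); case: is_edge; case: is_allowed;
by case: (U a); case: (U b).
Qed.

Lemma guess_spec x n k N m :
  context x n m -> cell m 0 rN = N -> cell m 0 rans = 0 ->
  (forall i j, i < n -> j < n -> cell m aK (i * n + j) = kept x n k (i, j)) ->
  (0 < cell (sem guess m) 0 rans)
    = has (fun q => good x n (select N (kept x n k) q (pairs n)).2) (iota 0 N).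
Proof.
move=> hm hN h0 hK; have [hn _ _ _] := hm.
apply: (@for_ind (fun j m => (0 < cell m 0 rans)
   = has (fun q => good x n (select N (kept x n k) q (pairs n)).2) (iota 0 j))) => //.
  by rewrite h0.
move=> q m1 hq hfr h1.
rewrite !sem_seq; set m2 := sem (Assign rp rq) _; set c := For _ _ (Put _ _ _).
have hm1 : context x n m1.
  by apply: context_eq hm => d i hd; rewrite hfr //;
    case/or3P: hd => [/andP[/eqP -> /orP[]/eqP ->]|/eqP ->|/eqP ->].
have hm2 : context x n m2 by do 3![apply: context_write => //].
have [hn2 _ _ _] := hm2.
have hU : forall i, i < n -> cell (sem c m2) aU i = 0.
  apply: (@for_ind (fun j m => forall i, i < j -> cell m aU i = 0)) => //.
  move=> j m3 hj _ h3 i /=; rewrite ltnS leq_eqVlt => /orP[->//|/h3 ->].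
  by case: ifP.
have hm3 : context x n (sem c m2).
  by apply: context_eq hm2 => d i hd; rewrite sem_frame //;
    case/or3P: hd => [/andP[/eqP -> /orP[]/eqP ->]|/eqP ->|/eqP ->].
have [||||h4 h5] := @select_arcs_spec x n (kept x n k) N q (sem c m2) hm3 _ _ _ _ hU.
- by move=> i j hi hj; rewrite sem_frame // -[cell m2 _ _]/(cell m1 _ _) hfr // hK.
- by rewrite sem_frame // -[cell m2 _ _]/(cell m1 _ _) hfr.
- by rewrite sem_frame //.
- by rewrite sem_frame //.
set l := (select _ _ _ _).2 in h4 h5; set m4 := sem select_arcs _ in h4 h5 *.
have hm4 : context x n m4.
  by apply: context_eq hm3 => d i hd; rewrite /m4 sem_frame //;
    case/or3P: hd => [/andP[/eqP -> /orP[]/eqP ->]|/eqP ->|/eqP ->].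
have h6 := check_cover_spec hm4 h4 h5.
have h7 : cell (sem check_cover m4) 0 rans = cell m1 0 rans.
  by rewrite 3?sem_frame.
rewrite -[in iota _ _](addn1 q) iotaD has_cat -h1 /= h6 h7 addn_gt0 orbF.
by rewrite lt0b.
Qed.

Lemma order_of_double n : order_of (n * n + n * n) = n.
Proof.
rewrite /order_of (eq_in_count (a2 := fun i => i < n)); last first.
  by move=> i _; apply/idP/idP => h; nia.
(* The range of the count in [order_of] reaches far enough to contain all [i < n]. *)
have hn : n <= n * n + n * n by nia.
rewrite -[in iota _ _](subnKC hn) iotaD count_cat.
rewrite (eq_in_count (a2 := predT)); last by move=> i; rewrite mem_iota.
rewrite count_predT size_iota (eq_in_count (a2 := pred0)).
  by rewrite count_pred0 addn0.
by move=> i; rewrite mem_iota add0n => /andP[h _]; rewrite ltnNge h.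
Qed.

Lemma order_of_le L : order_of L <= L.
Proof. by rewrite -[leqRHS](size_iota 0) count_size. Qed.

Definition decide : cmd :=
  Input rk;; Input rL;; read_word;; set_power 1;; find_order;; set_rows;;
  validate;; set_kept;; guess;; answer.

Lemma decide_spec x k :
  cell (sem decide (start (encode_input x k))) 0 rans = accept x k.
Proof.
rewrite /decide !sem_seq.
set m1 := sem (Input rL) _.
set m2 := sem read_word m1.
set m3 := sem (set_power 1) m2.
set m4 := sem find_order m3.
set m5 := sem set_rows m4.
set m6 := sem validate m5.
set m7 := sem set_kept m6.
set m8 := sem guess m7.
set n := order_of (size x).
have X2 p : cell m2 aX p = nth false x p.
  rewrite (@read_word_spec m1 (map nat_of_bool x)) //; last by rewrite size_map.
  case: (ltnP p (size x)) => hp; first by rewrite (nth_map false).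
  by rewrite !nth_default // size_map.
have N3 : cell m3 0 rN = 2 ^ width k.
  by rewrite /m3 set_power_spec mul1n /m2 sem_frame.
have L3 : cell m3 0 rL = size x by rewrite /m3 /m2 2?sem_frame.
have n4 : cell m4 0 rn = n by rewrite /m4 find_order_spec L3.
have L4 : cell m4 0 rL = size x by rewrite /m4 sem_frame.
have := set_rows_spec m4; rewrite -/m5 n4 L4 => -[R5 s5 ok5].
have hm5 : context x n m5.
  split=> // [|p]; first by rewrite /m5 sem_frame.
  by rewrite /m5 /m4 /m3 3?sem_frame.
have T5 i : cell m5 aT i = 0 by rewrite /m5 /m4 /m3 /m2 4?sem_frame.
have := validate_spec hm5 ok5 T5; rewrite -/m6 => -[ok6 T6 cnt6].
have hm6 : context x n m6.
  by apply: context_eq hm5 => d i hd; rewrite /m6 sem_frame //;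
    case/or3P: hd => [/andP[/eqP -> /orP[]/eqP ->]|/eqP ->|/eqP ->].
have k6 : cell m6 0 rk = k by rewrite /m6 /m5 /m4 /m3 /m2 5?sem_frame.
have K7 := set_kept_spec hm6 k6 T6; rewrite -/m7 in K7.
have hm7 : context x n m7.
  by apply: context_eq hm6 => d i hd; rewrite /m7 sem_frame //;
    case/or3P: hd => [/andP[/eqP -> /orP[]/eqP ->]|/eqP ->|/eqP ->].
have N7 : cell m7 0 rN = 2 ^ width k by rewrite /m7 /m6 /m5 /m4 4?sem_frame.
have a7 : cell m7 0 rans = 0 by rewrite /m7 /m6 /m5 /m4 /m3 /m2 6?sem_frame.
have G8 := guess_spec hm7 N7 a7 K7; rewrite -/m8 in G8.
have ok8 : cell m8 0 rok = cell m6 0 rok by rewrite /m8 /m7 2?sem_frame.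
have cnt8 : cell m8 0 rcnt = cell m6 0 rcnt by rewrite /m8 /m7 2?sem_frame.
have k8 : cell m8 0 rk = k by rewrite /m8 /m7 2?sem_frame.
clearbody m8; rewrite /= ok8 ok6 cnt8 cnt6 k8 /accept -/n -G8.
case: eqP => _ //=; last by rewrite subn0; case: (cell m8 0 0); lia.
case: (all _ _) => /=; last by case: (cell m8 0 0); lia.
by case: eqP => [->|h]; case: (cell m8 0 0); lia.
Qed.

(** * Running time *)

Fixpoint depth (c : cmd) : nat :=
  match c with
  | Assign _ _ | Put _ _ _ | Input _ => 0
  | Seq c1 c2 => maxn (depth c1) (depth c2)
  | If e c => depth c
  | For _ _ c => (depth c).+1
  end.

(** Every level of nesting contributes a factor of at most [B.+1], and the cost with all bounds
    equal to 1 collects the constants. The successor is there because a loop without rounds still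
    costs something. *)
Lemma cost_le b B c :
  all (fun v => b v <= B) (loop_bounds c) ->
  cost b c <= cost (fun=> 1) c * B.+1 ^ depth c.
Proof.
elim: c => [v e|a e1 e2|v|c1 IH1 c2 IH2|e c IH|i v c IH] /=; rewrite ?muln1 //.
- rewrite all_cat => /andP[/IH1 h1 /IH2 h2]; rewrite mulnDl.
  apply: leq_add; [apply: leq_trans h1 _|apply: leq_trans h2 _];
  by rewrite leq_mul2l leq_pexp2l ?leq_maxl ?leq_maxr ?orbT.
- move=> /IH h; rewrite mulnDl; apply: leq_add => //.
  by rewrite leq_pmulr // expn_gt0.
- move=> /andP[hv /IH h]; rewrite mul1n expnS.
  have hp : 0 < B.+1 ^ depth c by rewrite expn_gt0.
  have := leq_mul hv (leq_add (leqnn 6) h); nia.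
Qed.

(** With [w] equal to 4k, this lets [2 ^ width k] pay for the two loops that compute it, and is the
    origin of the 4 in [power_cost]. *)
Lemma width_le w : w.+1 ^ 2 <= 4 * 2 ^ (w * w).
Proof. have := @ltn_expl 2 (w * w) isT; nia. Qed.

Definition power_cost (d : nat) : nat :=
  cost (fun=> 1) (Assign rw (rk +! rk +! rk +! rk))
  + 4 * cost (fun=> 1)
          (Assign rN (Lit d);; For ri rw (For rj rw (Assign rN (rN +! rN)))).

Lemma set_power_implements d m :
  implements (set_power d) m (power_cost d * 2 ^ width (cell m 0 rk)).
Proof.
set k := cell m 0 rk; pose w := k + k + k + k.
set c := Assign rN (Lit d);; For ri rw (For rj rw (Assign rN (rN +! rN))).
set a := Assign rw (rk +! rk +! rk +! rk).
apply: (@implementsW _ _ (cost (fun=> 1) a + cost (fun=> w) c)).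
  rewrite mulnDl; apply: leq_add; first by rewrite leq_pmulr ?expn_gt0.
  apply: leq_trans (@cost_le (fun=> w) w c _) _; first by rewrite /= leqnn.
  by rewrite mulnAC mulnC leq_mul2r width_le orbT.
apply: implements_seq; first exact: implements_cost.
by apply: implements_cost => //; rewrite /= leqnn.
Qed.

(** For [d] the constant of the running time, this program computes the factor [f] that [FPT] asks
    for. *)
Definition power (d : nat) : cmd :=
  Input rk;; set_power d;; Assign rans rN.

Lemma computable_power d : computable (fun k => d * 2 ^ width k).
Proof.
exists (compile (power d) 0 0) => k.
pose m1 := sem (Input rk) (start [:: k]).
have h : implements (power d) (start [:: k])
    (1 + (power_cost d * 2 ^ width k + size (compile (Assign rans rN) 0 0))).
  apply: implements_seq; first exact: implements_input.
  apply: implements_seq; first exact: set_power_implements.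
  exact: implements_assign.
have e : cell (sem (power d) (start [:: k])) 0 rans = d * 2 ^ width k.
  by rewrite -[LHS]/(cell (sem (set_power d) m1) 0 rN) set_power_spec.
by eexists; rewrite -e; exact: implements_outputs h (leqnn _).
Qed.

(** Some stages compute the loop bounds of later ones, so [implements_cost] does not apply to the
    program as a whole. The stages are timed one by one, from the values of [rn] and [rN] at their
    start. *)
Lemma decide_time : exists D, forall x k,
  implements decide (start (encode_input x k))
    (D * 2 ^ width k * (size x + 1) ^ 2).
Proof.
pose q1 := Assign rgood (Lit 1);; Assign rp rq;;
    For ri rn (Put aU ri (Lit 0));; select_arcs;; check_cover;;
    Assign rans (rans +! rgood).
pose C := cost (fun=> 1).
(* The sum is nested like the stages of [decide]; [7 + (6 + C q1)] belongs to [guess], whose body is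
   [q1]. *)
exists (1 + (1 + (C read_word + (power_cost 1 + (C find_order + (C set_rows
  + (C validate + (C set_kept + ((7 + (6 + C q1)) + C answer))))))))) => x k.
set L := size x; set N := 2 ^ width k; set B := (L + 1) ^ 2.
have N0 : 0 < N by rewrite expn_gt0.
have B0 : 0 < B by rewrite expn_gt0 addn1.
have step c m : wf c -> constant_bounds c -> depth c <= 2 ->
    all (fun v => cell m 0 v <= L) (loop_bounds c) -> implements c m (C c * N * B).
  move=> h1 h2 h3 h4.
  apply: (@implementsW _ _ (cost (cell m 0) c)); last first.
    by apply: implements_cost => //; apply/allP.
  apply: leq_trans (cost_le h4) _; rewrite -mulnA leq_mul2l /B addn1.
  apply/orP; right; apply: leq_trans (leq_pmull _ N0).
  by rewrite leq_pexp2l.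
have N1 : 1 <= N * B by rewrite muln_gt0 N0.
have N2 c : c <= c * (N * B) by rewrite leq_pmulr.
rewrite -mulnA mulnDl /decide; apply: implements_seq.
  by refine (implementsW (N2 1) _); exact: implements_input.
set m1 := sem (Input rk) _; rewrite mulnDl; apply: implements_seq.
  by refine (implementsW (N2 1) _); exact: implements_input.
set m2 := sem (Input rL) _; rewrite mulnDl mulnA; apply: implements_seq.
  by apply: step => //=; rewrite leqnn.
set m3 := sem read_word _; rewrite mulnDl; apply: implements_seq.
  refine (implementsW _ (@set_power_implements _ _)).
  rewrite /m3 sem_frame // leq_mul2l; apply/orP; right.
  by rewrite -[cell _ _ _]/k -/N leq_pmulr.
set m4 := sem (set_power 1) _; rewrite mulnDl mulnA; apply: implements_seq.
  apply: step => //; rewrite /m4 /m3 [loop_bounds _]/= /all 2?sem_frame //.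
  by rewrite andbT.
set m5 := sem find_order _.
have n5 : cell m5 0 rn <= L.
  by rewrite find_order_spec /m4 /m3 2?sem_frame //; exact: order_of_le.
have N5 : cell m5 0 rN = N.
  by rewrite /m5 sem_frame // /m4 set_power_spec mul1n /m3 sem_frame.
clearbody m5; rewrite mulnDl mulnA; apply: implements_seq.
  by apply: step => //; rewrite /= n5.
set m6 := sem set_rows _.
have n6 : cell m6 0 rn <= L by rewrite /m6 sem_frame.
have N6 : cell m6 0 rN = N by rewrite /m6 sem_frame.
clearbody m6; rewrite mulnDl mulnA; apply: implements_seq.
  by apply: step => //; rewrite /= n6.
set m7 := sem validate _.
have n7 : cell m7 0 rn <= L by rewrite /m7 sem_frame.
have N7 : cell m7 0 rN = N by rewrite /m7 sem_frame.
clearbody m7; rewrite mulnDl mulnA; apply: implements_seq.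
  by apply: step => //; rewrite /= n7.
set m8 := sem set_kept _.
have n8 : cell m8 0 rn <= L by rewrite /m8 sem_frame.
have N8 : cell m8 0 rN = N by rewrite /m8 sem_frame.
clearbody m8.
rewrite mulnDl; apply: implements_seq; last first.
  by refine (implementsW (N2 _) _); exact: implements_assign.
(* Only the outer loop of [guess] runs [N] times; the loops in its body are bounded by [L] and nest
   to depth 2, whence [N * B]. *)
pose b v := if v == rN then N else L.
apply: (@implementsW _ _ (cost b guess)); last first.
  by apply: implements_cost => //; rewrite /= N8 n8 /b /= leqnn.
have hq : cost b q1 <= C q1 * B 
  by rewrite /B addn1; apply: (@cost_le b L q1); rewrite /= /b /= leqnn.
rewrite -[cost b guess]/(7 + N * (6 + cost b q1)).
move: hq; move: (cost b q1) (C q1) => u v hq.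
have : u * N <= v * B * N by rewrite leq_mul2r hq orbT.
nia.
Qed.

(** * Guessed arcs and matchings *)

(** The [v] low bits are those still unread after [s]; the induction needs them because every pair
    in [K] consumes one bit. *)
Lemma select_complete (K b : pred (nat * nat)) s v :
  exists2 q, q < 2 ^ count K s & forall l,
    (foldl (select_step (2 ^ (count K s + v)) K) (q * 2 ^ v, l) s).2
      = l ++ [seq e <- s | K e && b e].
Proof.
elim: s v => [|e s IH] v; first by exists 0 => // l; rewrite /= cats0.
rewrite [count K _]/= /=; case: (boolP (K e)) => he; last first.
  have [q hq h] := IH v; exists q => // l.
  by rewrite add0n {2}/select_step (negbTE he) h.
have [q hq h] := IH v.+1; set r := count K s in hq h *.
(* The bit of [e] goes in front. Doubling lifts it to the weight [2 ^ (r + v.+1)], which is the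
   modulus, so the comparison detects it and the subtraction removes it. *)
exists (q + b e * 2 ^ r).
  by rewrite add1n expnS; case: (b e); lia.
move=> l; rewrite add1n addSnnS {2}/select_step he /=.
have e2 : (q + b e * 2 ^ r) * 2 ^ v + (q + b e * 2 ^ r) * 2 ^ v
    = q * 2 ^ v.+1 + b e * 2 ^ (r + v.+1).
  by rewrite expnD expnS; nia.
have hlt : q * 2 ^ v.+1 < 2 ^ (r + v.+1).
  by rewrite expnD ltn_pmul2r // expn_gt0.
rewrite e2; case: (b e); last by rewrite mul0n addn0 leqNgt hlt /= h.
by rewrite mul1n leq_addl addnK h cat_rcons.
Qed.

Lemma select_exists (K b : pred (nat * nat)) s w : count K s <= w ->
  exists2 q, q < 2 ^ w & (select (2 ^ w) K q s).2 = [seq e <- s | K e && b e].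
Proof.
move=> hw; have [q hq h] := select_complete K b s (w - count K s).
(* Bits are read from the top, so a shorter guess is padded with zeros at the bottom. *)
rewrite subnKC // in h; exists (q * 2 ^ (w - count K s)); last exact: h.
by rewrite -{2}(subnKC hw) expnD ltn_pmul2r // expn_gt0.
Qed.

Lemma mem_select N (K : pred (nat * nat)) q s e :
  e \in (select N K q s).2 -> K e /\ e \in s.
Proof.
suff h l : e \in (foldl (select_step N K) (q, l) s).2 ->
    (e \in l) \/ (K e /\ e \in s) by case/h.
elim: s q l => [|a s IH] q l /=; first by left.
rewrite {2}/select_step; case: ifP => ha /=; last first.
  by case/IH => [|[h1 h2]]; [left|right; rewrite inE h2 orbT].
case: ifP => _ /IH [|[h1 h2]].
- by rewrite mem_rcons inE => /orP[/eqP ->|]; [right; rewrite inE eqxx|left].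
- by right; rewrite inE h2 orbT.
- by left.
- by right; rewrite inE h2 orbT.
Qed.

Lemma mem_ends (T : eqType) (l : seq (T * T)) v :
  reflect (exists2 e, e \in l & v \in [:: e.1; e.2]) (v \in ends l).
Proof. by apply: (iffP flatten_mapP) => -[e h1 h2]; exists e. Qed.

Lemma uniq_ends_inj (T : eqType) (l : seq (T * T)) e f v :
  uniq (ends l) -> e \in l -> f \in l ->
  v \in [:: e.1; e.2] -> v \in [:: f.1; f.2] -> e = f.
Proof.
elim: l => //= a l IH; rewrite /ends /= -/(ends l) => hu.
have [/hasPn h1 h2] :
    ~~ has (mem [:: a.1; a.2]) (ends l) /\ uniq (ends l).
  have : uniq ([:: a.1; a.2] ++ ends l) by [].
  by rewrite cat_uniq => /and3P[].
move=> + + hv hw; rewrite !inE => /orP[/eqP ea|he] /orP[/eqP fa|hf];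
  rewrite ?ea ?fa // in hv hw *.
- by case/negP: (h1 v (introT (mem_ends l v) (ex_intro2 _ _ f hf hw))).
- by case/negP: (h1 v (introT (mem_ends l v) (ex_intro2 _ _ e he hv))).
- exact: IH.
Qed.

Lemma uniq_ends (T : eqType) (l : seq (T * T)) :
  uniq l -> (forall e, e \in l -> e.1 != e.2) ->
  (forall e f v, e \in l -> f \in l -> v \in [:: e.1; e.2] ->
     v \in [:: f.1; f.2] -> e = f) ->
  uniq (ends l).
Proof.
elim: l => //= a l IH /andP[ha hu] hn hd.
change (is_true (uniq ([:: a.1; a.2] ++ ends l))); rewrite cat_uniq IH //; last first.
- by move=> e f v he hf; apply: hd; rewrite inE ?he ?hf orbT.
- by move=> e he; apply: hn; rewrite inE he orbT.
rewrite andbT /= inE andbT hn ?inE ?eqxx //=; apply/hasPn => v /mem_ends[e he hv].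
apply/negP => hv'; move: ha; rewrite (hd a e v) ?he // ?inE ?eqxx ?he ?orbT //.
Qed.

(** * Matchings, covers and their orientations *)

Lemma set2_eq (T : finType) (a b c d : T) :
  [set a; b] = [set c; d] -> (a = c /\ b = d) \/ (a = d /\ b = c).
Proof.
move=> e.
have : a \in [set c; d] by rewrite -e set21.
have : b \in [set c; d] by rewrite -e set22.
have : c \in [set a; b] by rewrite e set21.
have : d \in [set a; b] by rewrite e set22.
rewrite !inE => /orP[]/eqP hd /orP[]/eqP hc /orP[]/eqP hb /orP[]/eqP ha;
  by [left; split; congruence|right; split; congruence].
Qed.

Lemma matching_set2_inj (V : finType) (M : {set {set V}}) (a b c : V) :
  trivIset M -> [set a; b] \in M -> [set a; c] \in M -> b = c.
Proof.
move=> hM hb hc; case: (eqVneq [set a; b] [set a; c]) => [|hn].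
  by case/set2_eq => [[]|[-> ->]].
have := trivIsetP hM _ _ hb hc hn => /disjointFr/(_ (set21 a b)).
by rewrite set21.
Qed.

(** Otherwise [e] could be added to [M], so by maximality it lies in [M] and is disjoint from
    itself, although it has two elements. *)
Lemma maximal_touches (V : finType) (G : sgraph V) (M : {set {set V}}) e :
  maximal_matching G M -> e \in edges G ->
  exists2 f, f \in M & ~~ [disjoint e & f].
Proof.
move=> /maxsetP[/andP[hM ht] hmax] he; apply/exists_inP; rewrite -[X in is_true X]negbK.
rewrite negb_exists_in; apply/negP => /forall_inP hd.
have hd' f : f \in M -> [disjoint e & f] by move=> /hd; rewrite negbK.
have eM : e \in M.
  rewrite -(hmax (e |: M)) ?setU11 ?subsetUr // /matching.
  rewrite subUset sub1set he hM /=; apply/trivIsetP => f g.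
  rewrite !inE => /orP[/eqP ->|hf] /orP[/eqP ->|hg] hn.
  - by rewrite eqxx in hn.
  - exact: hd'.
  - by rewrite disjoint_sym; exact: hd'.
  - exact: (trivIsetP ht).
have := hd' _ eM; rewrite -setI_eq0 setIid => /eqP e0.
by have := edgesP he; rewrite e0 cards0.
Qed.

(* A matching inside [U] that touches every edge outside [U] extends greedily
   inside [U] to a maximal one, to which no edge can be added. *)
Lemma extend_cover (V : finType) (G : sgraph V) (U M : {set {set V}}) :
  U \subset edges G -> M \subset U -> trivIset M ->
  (forall e, e \in edges G -> e \notin U ->
     exists2 f, f \in M & ~~ [disjoint e & f]) ->
  ext_em G U.
Proof.
move=> hU hM ht hc.
have [M1 /maxsetP[/andP[hM1 ht1] hmax] hMM] :=
  @maxset_exists _ (fun M => (M \subset U) && trivIset M) M (introT andP (conj hM ht)).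
exists M1 => //; apply/maxsetP; split.
  by rewrite /matching ht1 (subset_trans hM1 hU).
move=> M2 /andP[hM2 ht2] h12; apply/eqP; rewrite eqEsubset h12 andbT.
apply/subsetP => e he; case: (boolP (e \in U)) => heU.
  rewrite -(hmax (e |: M1)) ?setU11 ?subsetUr // subUset sub1set heU hM1 /=.
  by apply: trivIsetS ht2; rewrite subUset sub1set he h12.
have [f hf hef] := hc _ (subsetP hM2 _ he) heU.
have hf1 := subsetP hMM _ hf.
case: (eqVneq e f) => [->//|hn].
by rewrite (trivIsetP ht2 _ _ he (subsetP h12 _ hf1) hn) in hef.
Qed.

(* A matching all of whose edges meet [T], encoded by a map [g] that sends one
   end, chosen in [T], of each edge to the other end, and fixes all the other
   vertices. *)
Definition covered (V : finType) (g : V -> V) (v : V) : Prop :=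
  g v <> v \/ exists2 u, u <> v & g u = v.

Definition arc_map (V : finType) (T : pred V) (w a : rel V) (g : V -> V) : Prop :=
  [/\ forall i, g i <> i -> T i /\ w i (g i),
      forall i j, g i <> i -> g j <> j -> g i = g j -> i = j,
      forall i, g (g i) = g i
    & forall i j, a i j -> covered g i \/ covered g j].

(** The abandoned head [g i] is outside [T], so every covered vertex of [T] stays covered, and the
    edges of [a] have both ends in [T]. The new head [j] is free: being outside [T] it is no tail,
    and it is no value of [g] on [T]. *)
Lemma arc_map_replace (V : finType) (T : pred V) (w a : rel V) (g : V -> V) i j :
  (forall u v, a u v -> T u && T v) ->
  arc_map T w a g -> T i -> ~~ T (g i) -> w i j -> ~~ T j ->
  (forall u, T u -> g u <> j) ->
  arc_map T w a (fun u => if u == i then j else g u).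
Proof.
move=> haT [h1 h2 h3 h4] Ti Tgi wij Tj hj.
have gi : g i <> i by move=> e; rewrite e Ti in Tgi.
have ij : j <> i by move=> e; rewrite e Ti in Tj.
have gj : g j = j by apply/eqP/negP => /negP/eqP /h1[]; rewrite (negbTE Tj).
have cov v : T v -> covered g v -> covered (fun u => if u == i then j else g u) v.
  move=> Tv [hv|[u huv hu]]; first by left; case: eqP => [->|].
  right; exists u => //; case: eqP => // e.
  by rewrite -hu e (negbTE Tgi) in Tv.
split.
- by move=> u; case: (u =P i) => [-> _|_ /h1].
- move=> u v; case: (u =P i) => [->|nu]; case: (v =P i) => [->|nv] // hu hv e.
  + by case: (hj v) => //; case: (h1 v hv).
  + by case: (hj u) => //; case: (h1 u hu).
  + exact: h2.
- move=> u; case: (u =P i) => [_|nu]; first by case: eqP => // _; exact: gj.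
  case: (g u =P i) => [e|//]; case: gi; by rewrite -e h3.
- move=> u v huv; have /andP[Tu Tv] := haT _ _ huv.
  by case: (h4 _ _ huv) => hc; [left|right]; apply: cov.
Qed.

(* Replacing a head that is preceded by many free neighbours by one of these
   decreases the sum of the heads. *)
Lemma arc_map_small (n r : nat) (T : pred 'I_n) (w a : rel 'I_n) (g : 'I_n -> 'I_n) :
  (forall u v, a u v -> T u && T v) -> #|T| <= r -> arc_map T w a g ->
  exists2 g : 'I_n -> 'I_n, arc_map T w a g
    & forall i, g i <> i ->
        T (g i) \/ #|[pred j : 'I_n | [&& w i j, ~~ T j & j < g i]]| < r.
Proof.
move=> haT hr; have [s] := ubnP (\sum_i g i); elim: s g => // s IH g hs hg.
pose bad i := [&& g i != i, ~~ T (g i)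
  & r <= #|[pred j : 'I_n | [&& w i j, ~~ T j & j < g i]]|].
case: (pickP bad) => [i /and3P[/eqP gi Tgi hri]|hbad]; last first.
  exists g => // i hi; move: (hbad i); rewrite /bad.
  have -> /= : g i != i by apply/eqP.
  case: (T _) => /=; first by left.
  by right; rewrite ltnNge; apply/negbT.
have [Ti _] : T i /\ w i (g i) by case: hg => h _ _ _; exact: h.
(* The image of [T] under [g] has at most [r] elements, and one of them is [g i], which is not among
   the at least [r] candidates below it. So some candidate lies outside the image. *)
have [j /and3P[wij Tj hji] hj] : exists2 j : 'I_n,
    [&& w i j, ~~ T j & j < g i] & j \notin [seq g u | u in T].
  apply/exists_inP; rewrite -[X in is_true X]negbK negb_exists_in.
  apply/negP => /forall_inP hall.
  suff: r < #|[set g u | u in T]| by rewrite ltnNge (leq_trans (leq_imset_card _ _) hr).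
  apply: leq_ltn_trans hri _; apply: proper_card; apply/properP; split.
    apply/subsetP => j hj; have := hall j hj; rewrite negbK => /imageP[u hu ->].
    exact: imset_f.
  by exists (g i); [exact: imset_f|rewrite inE ltnn !andbF].
apply: (IH (fun u => if u == i then j else g u)).
  rewrite ltnS in hs; apply: leq_trans hs.
  rewrite (bigD1 i) //= [X in _ < X](bigD1 i) //= eqxx.
  rewrite -addSn leq_add // leq_eqVlt; apply/orP; left; apply/eqP.
  by apply: eq_bigr => u /negbTE ->.
apply: arc_map_replace => // u Tu e; case/negP: hj; apply/imageP; by exists u.
Qed.

Lemma edge_neq (V : finType) (G : sgraph V) i j : [set i; j] \in edges G -> i != j.
Proof.
move=> /(@edgesP _ G) h; apply/eqP => e.
by move: h; rewrite e setUid cards1.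
Qed.

Lemma maximal_arc_map (n : nat) (G : sgraph 'I_n) (U M : {set {set 'I_n}})
    (T : pred 'I_n) :
  let a : rel 'I_n := fun i j => [set i; j] \in edges G :\: U in
  (forall u v, a u v -> T u && T v) ->
  maximal_matching G M -> M \subset U ->
  exists g, arc_map T (fun i j => [set i; j] \in U) a g.
Proof.
move=> a haT hM hMU.
have /andP[hME ht] : matching G M by case/maxsetP: hM.
pose m i j := [set i; j] \in M.
have mC i j : m i j = m j i by rewrite /m setUC.
have minj i j k : m i j -> m i k -> j = k by exact: matching_set2_inj.
have mneq i j : m i j -> i != j by move/(subsetP hME)/edge_neq.
(* A matching edge points from its terminal to its non-terminal, or from the smaller to the larger
   of two terminals; an edge without terminals is dropped. *)
pose P i j := [&& m i j, T i & ~~ T j || (i < j)].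
pose g i := odflt i [pick j | P i j].
have gP i : (g i = i /\ (forall j, ~~ P i j)) \/ P i (g i).
  rewrite /g; case: pickP => [j hj|h] /=; first by right.
  by left; split=> // j; rewrite h.
have gPn i : g i <> i -> P i (g i) by case: (gP i) => [[]|].
have gE i j : P i j -> g i = j.
  move=> hP; case: (gP i) => [[_ /(_ j)]|/and3P[h _ _]]; first by rewrite hP.
  by case/and3P: hP => h' _ _; exact: minj h h'.
exists g; split.
- by move=> i /gPn /and3P[h -> _]; split=> //; exact: (subsetP hMU).
- move=> i j /gPn /and3P[hi _ _] /gPn /and3P[hj _ _] e.
  by apply: (minj (g i)); rewrite mC // e.
- move=> i; case: (g i =P i) => [e|/gPn hi]; first by rewrite !e.
  case: (g (g i) =P g i) => [//|/gPn hgi].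
  have /and3P[hm Ti hlt] := hi; have /and3P[hm2 Tgi hlt2] := hgi.
  have e : g (g i) = i by apply: (minj (g i)) => //; rewrite mC.
  by move: hlt hlt2; rewrite e Ti Tgi /= => h1 h2; lia.
(* A matched terminal [v] is a tail unless its partner [c] is a smaller terminal, and in that case
   it is the head of [c]. *)
- have cov v c : T v -> m v c -> covered g v.
    move=> Tv hvc; have nvc := mneq _ _ hvc.
    case: (boolP (P v c)) => [/gE e|].
      by left; rewrite e => e'; rewrite e' eqxx in nvc.
    rewrite /P hvc Tv /= negb_or negbK -leqNgt => /andP[Tc hcv].
    right; exists c; first by move=> e; rewrite e eqxx in nvc.
    apply: gE; rewrite /P mC hvc Tc /= ltn_neqAle hcv andbT orbC.
    by rewrite eq_sym -val_eqE /= in nvc; rewrite nvc.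
  move=> i j hij; have /andP[Ti Tj] := haT _ _ hij.
  have [f hf] : exists2 f, f \in M & ~~ [disjoint [set i; j] & f].
    by apply: (maximal_touches hM); case/setDP: hij.
  have [p [q epq]] : exists p q, f = [set p; q].
    have /eqP/cards2P[p [q [_ ->]]] := edgesP (subsetP hME _ hf).
    by exists p, q.
  have touch v : v \in f -> T v -> covered g v.
    rewrite epq !inE => /orP[]/eqP -> Tv; first by apply: (cov p q); rewrite // /m -epq.
    by apply: (cov q p); rewrite // mC /m -epq.
  case/pred0Pn => v /=; rewrite !inE => /andP[/orP[]/eqP -> hv].
    by left; apply: touch.
  by right; apply: touch.
Qed.

(** * Correctness on encoded instances *)

Lemma count_iota_ord (P : pred nat) n : count P (iota 0 n) = #|[pred i : 'I_n | P i]|.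
Proof. by rewrite -val_enum_ord count_map cardE -size_filter enumT. Qed.

Lemma pairs_ord n :
  pairs n = [seq (val p.1, val p.2) | p <- enum {: 'I_n * 'I_n}].
Proof.
rewrite /pairs -(val_enum_ord n) allpairs_mapl allpairs_mapr.
by rewrite !enumT [in RHS]unlock /= /prod_enum !enumT map_allpairs.
Qed.

Lemma mem_pairs n e : (e \in pairs n) = (e.1 < n) && (e.2 < n).
Proof.
case: e => a b; apply/allpairsP/andP => /= [[[i j] /=]|[ha hb]].
  by rewrite !mem_iota => -[hi hj [-> ->]].
by exists (a, b); rewrite !mem_iota.
Qed.

Lemma uniq_pairs n : uniq (pairs n).
Proof. by apply: allpairs_uniq; rewrite ?iota_uniq // => -[a b] [c d] _ _ [-> ->]. Qed.

Lemma count_pairs (P : pred (nat * nat)) n :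
  count P (pairs n) = #|[pred p : 'I_n * 'I_n | P (val p.1, val p.2)]|.
Proof. by rewrite pairs_ord count_map cardE -size_filter enumT. Qed.

Lemma count_allpairs (S T : Type) (P : pred (S * T)) s t :
  count P [seq (i, j) | i <- s, j <- t]
    = \sum_(i <- s) count (fun j => P (i, j)) t.
Proof.
elim: s => [|a s IH] /=; first by rewrite big_nil.
by rewrite big_cons count_cat count_map IH.
Qed.

Lemma count_first (P : pred nat) c n :
  count (fun j => P j && (count P (iota 0 j) < c)) (iota 0 n)
    = minn c (count P (iota 0 n)).
Proof.
elim: n => [|n IH]; first by rewrite minn0.
rewrite -addn1 iotaD !count_cat IH /= add0n !addn0; case: (P n) => /=; lia.
Qed.

(** The row of each terminal contains a forbidden pair. *)
Lemma terminal_le x n : count (terminal x n) (iota 0 n)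
  <= count (is_forbidden x n) (pairs n).
Proof.
rewrite count_allpairs -sum1_count big_mkcond; apply: leq_sum => i _.
by case: ifP => //; rewrite /terminal has_count.
Qed.

(** By [terminal_le] there are at most 2k terminals. The row of each keeps at most 2k terminals and,
    by [count_first], at most 2k non-terminals. This makes 8k^2 pairs, while [width k] is 16k^2. *)
Lemma kept_le x n k : count (is_forbidden x n) (pairs n) = k + k ->
  count (kept x n k) (pairs n) <= width k.
Proof.
move=> hk; have := terminal_le x n; rewrite hk => ht.
rewrite count_allpairs.
have hrow i : count (fun j => kept x n k (i, j)) (iota 0 n)
    <= (if terminal x n i then 1 else 0) * (k + k + k + k).
  rewrite /kept /=; case: (terminal x n i) => /=; last by rewrite count_pred0.
  pose P j := is_allowed x n i j && ~~ terminal x n j.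
  pose Q j := P j && (count P (iota 0 j) < k + k).
  apply: (@leq_trans (count (predU (terminal x n) Q) (iota 0 n))).
    apply: sub_count => j /= /andP[ha]; rewrite /Q /P ha /=.
    by case: (terminal x n j).
  apply: leq_trans (leq_addr (count (predI (terminal x n) Q) (iota 0 n)) _) _.
  by rewrite count_predUI count_first mul1n -addnA leq_add // geq_minl.
apply: leq_trans (leq_sum _ (fun i _ => hrow i)) _.
rewrite -big_distrl /= -big_mkcond sum1_count /width; nia.
Qed.

(** * Encoding and decoding of instances *)

Lemma nth_allpairs (S T R : Type) (f : S -> T -> R) s t x0 y0 z0 a b :
  a < size s -> b < size t ->
  nth z0 [seq f x y | x <- s, y <- t] (a * size t + b)
    = f (nth x0 s a) (nth y0 t b).
Proof.
elim: s a => [|x s IH] [|a] //= ha hb; rewrite nth_cat size_map.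
  by rewrite add0n hb (nth_map y0).
by rewrite mulSn -addnA ltnNge leq_addr /= addKn IH.
Qed.

Lemma size_adjacency n (F : {set {set 'I_n}}) : size (adjacency_bits F) = n * n.
Proof. by rewrite size_allpairs size_enum_ord. Qed.

Lemma nth_adjacency n (F : {set {set 'I_n}}) (i j : 'I_n) :
  nth false (adjacency_bits F) (i * n + j) = ([set i; j] \in F).
Proof.
rewrite -[X in _ * X + _](size_enum_ord n).
by rewrite (nth_allpairs _ i j) ?size_enum_ord ?nth_ord_enum.
Qed.

Lemma ord_index n (i j : 'I_n) : i * n + j < n * n.
Proof. have := ltn_ord i; have := ltn_ord j; nia. Qed.

Lemma is_edge_encode n (G : sgraph 'I_n) U (i j : 'I_n) :
  is_edge (encode_instance G U) n i j = ([set i; j] \in edges G).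
Proof.
by rewrite /is_edge nth_cat size_adjacency ord_index nth_adjacency.
Qed.

Lemma is_allowed_encode n (G : sgraph 'I_n) U (i j : 'I_n) :
  is_allowed (encode_instance G U) n i j = ([set i; j] \in U).
Proof.
by rewrite /is_allowed nth_cat size_adjacency ltnNge leq_addr /= addKn nth_adjacency.
Qed.

Lemma is_forbidden_encode n (G : sgraph 'I_n) U (i j : 'I_n) :
  is_forbidden (encode_instance G U) n (val i, val j)
    = ([set i; j] \in edges G :\: U).
Proof.
by rewrite /is_forbidden is_edge_encode is_allowed_encode in_setD andbC.
Qed.

Lemma size_encode n (G : sgraph 'I_n) U : size (encode_instance G U) = n * n + n * n.
Proof. by rewrite size_cat !size_adjacency. Qed.

Lemma valid_encode n (G : sgraph 'I_n) (U : {set {set 'I_n}}) : U \subset edges G ->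
  all (valid (encode_instance G U) n) (pairs n).
Proof.
move=> hU; rewrite pairs_ord all_map; apply/allP => -[i j] _ /=.
rewrite /valid !is_edge_encode !is_allowed_encode [[set j; i]]setUC !eqxx /=.
apply/andP; split; apply/implyP; first exact: (subsetP hU).
by move/edge_neq.
Qed.

(** The ordered pairs are partitioned by their underlying edge; the class of {a, b} consists of (a,
    b) and (b, a), which differ because the edge has two elements. *)
Lemma card_arcs (V : finType) (S : {set {set V}}) :
  {in S, forall e : {set V}, #|e| = 2} ->
  #|[pred p : V * V | [set p.1; p.2] \in S]| = #|S| + #|S|.
Proof.
move=> hS; rewrite -[LHS]sum1_card (partition_big (fun p => [set p.1; p.2]) (mem S)) //=.
rewrite addnn -muln2 -sum_nat_const; apply: eq_bigr => e he.
have /eqP/cards2P[a [b [hab ee]]] := hS e he.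
have <- : #|[set (a, b); (b, a)]| = 2.
  by rewrite cards2 xpair_eqE negb_and hab.
rewrite -sum1_card; apply: eq_bigl => -[c d] /=.
rewrite !inE !xpair_eqE; apply/andP/idP => [[_ /eqP]|].
  by rewrite ee => /set2_eq[[-> ->]|[-> ->]]; rewrite !eqxx ?orbT.
case/orP => /andP[/eqP -> /eqP ->]; first by rewrite -ee he.
by rewrite setUC -ee he.
Qed.

Lemma count_forbidden_encode n (G : sgraph 'I_n) (U : {set {set 'I_n}}) : U \subset edges G ->
  count (is_forbidden (encode_instance G U) n) (pairs n)
    = (#|edges G| - #|U|) + (#|edges G| - #|U|).
Proof.
move=> hU; rewrite count_pairs.
have -> : #|edges G| - #|U| = #|edges G :\: U|.
  by rewrite cardsD (setIidPr hU).
rewrite -card_arcs; last by move=> e /setDP[he _]; exact: (edgesP he).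
by apply: eq_card => -[i j]; rewrite !inE is_forbidden_encode inE.
Qed.

(** Symmetry of the two matrices makes membership in the sets read off from them agree with the
    bits, and the empty diagonal gives every edge two elements. *)
Lemma decode_instance x n : n * n + n * n = size x ->
  all (valid x n) (pairs n) ->
  exists (G : sgraph 'I_n) (U : {set {set 'I_n}}), U \subset edges G /\ x = encode_instance G U.
Proof.
move=> hx hv.
pose S (r : nat -> nat -> bool) : {set {set 'I_n}} :=
  [set [set p.1; p.2] | p in [pred p : 'I_n * 'I_n | r p.1 p.2]].
have hv' (i j : 'I_n) : valid x n (val i, val j).
  by apply: (allP hv); rewrite mem_pairs !ltn_ord.
have memS (r : nat -> nat -> bool) (i j : 'I_n) : (forall i j : 'I_n, r i j = r j i) ->
    ([set i; j] \in S r) = r i j.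
  move=> hr; apply/imsetP/idP => [[[a b] /= hab]|h]; last by exists (i, j).
  by case/set2_eq => [[-> ->]|[-> ->]] //; rewrite hr.
have symE (i j : 'I_n) : is_edge x n i j = is_edge x n j i.
  by case/and4P: (hv' i j) => /eqP.
have symA (i j : 'I_n) : is_allowed x n i j = is_allowed x n j i.
  by case/and4P: (hv' i j) => _ /eqP.
have hE : {in S (is_edge x n), forall e : {set 'I_n}, #|e| = 2}.
  move=> e /imsetP[[i j] /= hij ->]; case/and4P: (hv' i j) => _ _ _ /implyP /(_ hij).
  by move=> h; rewrite cards2 -val_eqE h.
exists (SGraph hE), (S (is_allowed x n)); split.
  apply/subsetP => e /imsetP[[i j] /= hij ->]; rewrite memS //.
  by case/and4P: (hv' i j) => _ _ /implyP /(_ hij).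
apply: (@eq_from_nth _ false) => [|p hp]; first by rewrite size_encode.
have split_index q : q < n * n -> exists i j : 'I_n, q = i * n + j.
  move=> hq; have n0 : 0 < n by case: (n) hq.
  have h1 : q %/ n < n by rewrite ltn_divLR.
  have h2 : q %% n < n by rewrite ltn_mod.
  by exists (Ordinal h1), (Ordinal h2); rewrite /= -divn_eq.
rewrite nth_cat size_adjacency; case: ltnP => hpn.
  by have [i [j ->]] := split_index p hpn; rewrite nth_adjacency memS.
have hq : p - n * n < n * n by lia.
have [i [j e]] := split_index _ hq.
by rewrite e nth_adjacency memS // /is_allowed -e subnKC.
Qed.

Lemma count_iota_lt (P : pred nat) j n : j <= n ->
  count P (iota 0 j) = count (fun a => P a && (a < j)) (iota 0 n).
Proof.
move=> hj; rewrite -(subnKC hj) iotaD count_cat.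
rewrite [X in _ = _ + X](@eq_in_count _ _ pred0) ?count_pred0 ?addn0.
  by apply: eq_in_count => a; rewrite mem_iota /= add0n => ->; rewrite andbT.
by move=> a; rewrite mem_iota add0n => /andP[h _]; rewrite ltnNge h andbF.
Qed.

Lemma rank_encode n (G : sgraph 'I_n) U (i j : 'I_n) :
  let x := encode_instance G U in
  rank x n i j = #|[pred j' : 'I_n | [&& [set i; j'] \in U,
                      ~~ terminal x n j' & j' < j]]|.
Proof.
move=> x; rewrite /rank (count_iota_lt _ (ltnW (ltn_ord j))) count_iota_ord.
by apply: eq_card => a; rewrite !inE is_allowed_encode andbA.
Qed.

Lemma encode_good n (G : sgraph 'I_n) (U : {set {set 'I_n}}) :
  U \subset edges G ->
  let x := encode_instance G U in let k := #|edges G| - #|U| in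
  has (fun q => good x n (select (2 ^ width k) (kept x n k) q (pairs n)).2)
      (iota 0 (2 ^ width k))
  <-> ext_em G U.
Proof.
move=> hU x k; split.
  case/hasP => q _; set l := (select _ _ _ _).2 => /andP[hu hc].
  have hl e : e \in l -> kept x n k e /\ e \in pairs n by exact: mem_select.
  pose M := [set [set p.1; p.2] | p in
    [pred p : 'I_n * 'I_n | (val p.1, val p.2) \in l]].
  apply: (@extend_cover _ G U M) => //.
  - apply/subsetP => e /imsetP[[i j] /= hij ->].
    by have [/and3P[_ h _] _] := hl _ hij; rewrite is_allowed_encode in h.
  - apply/trivIsetP => e f /imsetP[[i j] /= hij ->] /imsetP[[i' j'] /= hij' ->].
    apply: contraNT => /pred0Pn[v /=]; rewrite !inE => /andP[hv hv'].
    have [] : (val i, val j) = (val i', val j').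
      apply: (@uniq_ends_inj _ l _ _ (val v)) => //=;
        by rewrite !inE !val_eqE.
    by move=> /val_inj -> /val_inj ->.
  - move=> e he heU; have /eqP/cards2P[a [b [_ ee]]] := edgesP he.
    have /allP/(_ (val a, val b)) := hc; rewrite mem_pairs !ltn_ord.
    rewrite is_forbidden_encode in_setD -ee he heU => /(_ isT) /= hab.
    have [v hv /mem_ends[[p q'] hp /= hvp]] : exists2 v, v \in e & val v \in ends l.
      by case/orP: hab => h; [exists a|exists b]; rewrite // ee !inE eqxx ?orbT.
    have [_] := hl _ hp; rewrite mem_pairs /= => /andP[h1 h2].
    exists [set Ordinal h1; Ordinal h2].
      by apply/imsetP; exists (Ordinal h1, Ordinal h2).
    apply/pred0Pn; exists v; rewrite /= hv !inE -?val_eqE /=.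
    by move: hvp; rewrite !inE.
case=> M hM hMU.
have hk : count (is_forbidden x n) (pairs n) = k + k by exact: count_forbidden_encode.
pose T (i : 'I_n) := terminal x n i.
pose a : rel 'I_n := fun i j => [set i; j] \in edges G :\: U.
have aE (i j : 'I_n) : is_forbidden x n (val i, val j) = a i j.
  exact: is_forbidden_encode.
have haT (i j : 'I_n) : a i j -> T i && T j.
  move=> hij; apply/andP; split; apply/hasP.
    by exists (val j); rewrite ?mem_iota ?ltn_ord // aE.
  exists (val i); rewrite ?mem_iota ?ltn_ord // aE.
  by rewrite /a setUC.
have hT : #|T| <= k + k.
  rewrite -hk; apply: leq_trans (terminal_le x n); by rewrite count_iota_ord.
have [g0 hg0] := maximal_arc_map haT hM hMU.
have [g [h1 h2 h3 h4] hg] := arc_map_small haT hT hg0.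
(* The guess to be found selects the arcs from [i] to [g i]. *)
pose b e := [exists i : 'I_n, [&& g i != i, val i == e.1 & val (g i) == e.2]].
have [q hq hl] := select_exists b (kept_le hk).
apply/hasP; exists q; first by rewrite mem_iota.
rewrite /good hl; set l := filter _ _.
(* No arc is lost by the restriction to [kept]: its tail is a terminal, and its head is a terminal
   or has rank below 2k. *)
have lP e : reflect (exists2 i, g i <> i & e = (val i, val (g i))) (e \in l).
  rewrite mem_filter mem_pairs; apply: (iffP idP) => [/andP[/andP[_]]|].
    case/existsP => i /and3P[/eqP hi /eqP e1 /eqP e2] _; exists i => //.
    by case: e e1 e2 => ? ? /= -> ->.
  case=> i hi ->; rewrite !ltn_ord !andbT /kept /= is_allowed_encode.
  have [Ti Ui] := h1 _ hi; rewrite -[terminal x n i]/(T i) Ti Ui /=.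
  apply/andP; split; last by apply/existsP; exists i; rewrite !eqxx !andbT; apply/eqP.
  by rewrite rank_encode; case: (hg i hi) => h; apply/orP; [left|right].
have neq i : g i <> i -> val i != val (g i).
  by move=> hi; rewrite val_eqE eq_sym; apply/eqP.
apply/andP; split.
  apply: uniq_ends; first by rewrite filter_uniq ?uniq_pairs.
    by move=> e /lP[i hi ->]; exact: neq.
  move=> e f v /lP[i hi ->] /lP[j hj ->] /=; rewrite !inE.
  suff : (v == val i) || (v == val (g i)) ->
         (v == val j) || (v == val (g j)) -> i = j.
    by move=> h hv hv'; rewrite (h hv hv').
  (* The common vertex is a tail or a head of either arc. Heads are fixed by [g] and hence are not
     tails, and different tails have different heads. *)
  case/orP => /eqP -> /orP[] /eqP /val_inj.
  - by [].
  - by move=> e'; case: hi; rewrite e' h3.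
  - by move=> e'; case: hj; rewrite -e' h3.
  - exact: h2.
have cov (v : 'I_n) : covered g v -> val v \in ends l.
  case=> [hv|[u hu hv]]; apply/mem_ends.
    by exists (val v, val (g v)); [apply/lP; exists v|rewrite !inE eqxx].
  exists (val u, val (g u)); last by rewrite !inE hv eqxx orbT.
  by apply/lP; exists u => // e; apply: hu; rewrite -hv e.
rewrite pairs_ord all_map; apply/allP => -[i j] _ /=; apply/implyP.
by rewrite aE => /h4[] /cov ->; rewrite ?orbT.
Qed.

Lemma accept_ext_em x k : accept x k <-> ext_em_dual x k.
Proof.
split.
  rewrite /accept; set n := order_of _ => /and4P[/eqP hx hv /eqP hk hq].
  have [G [U [hU ex]]] := decode_instance hx hv; rewrite ex in hk hq.
  have ek : k = #|edges G| - #|U|.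
    by move: hk; rewrite count_forbidden_encode // !addnn => /double_inj.
  exists n, G, U; split=> //; rewrite ek in hq; exact/encode_good.
case=> n [G [U [hU -> -> hext]]].
rewrite /accept size_encode order_of_double eqxx valid_encode //.
rewrite count_forbidden_encode // eqxx /=; exact/encode_good.
Qed.

Theorem theorem9 : FPT ext_em_dual.
Proof.
have [D hD] := decide_time.
exists (compile decide 0 0), (fun k => D * 2 ^ width k), 2.
split; first exact: computable_power.
move=> x k; exists (accept x k); split; last exact: accept_ext_em.
by rewrite -decide_spec; exact: implements_outputs (hD x k) (leqnn _).
Qed.
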